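(* Let $(\mathfrak{g}_\sigma,\mathfrak{q},\mathfrak{h}_\sigma)$ be a parabolic $CR$-triple with root system $\mathcal{R}=\mathcal{R}(\mathfrak{g},\mathfrak{h})$, parabolic set $\mathcal{Q}=\{\alpha\in\mathcal{R}\mid\mathfrak{g}^\alpha\subseteq\mathfrak{q}\}$ and induced involution $\mathrm{s}$ of $\mathcal{R}$. For $w$ in the Weyl group $\mathbf{W}(\mathcal{R})$ let $\mathfrak{q}_w=\mathfrak{h}\oplus\sum_{\alpha\in w(\mathcal{Q})}\mathfrak{g}^\alpha$. If $\dim_\mathbb{R}(\mathfrak{g}_\sigma,\mathfrak{q})\le\dim_\mathbb{R}(\mathfrak{g}_\sigma,\mathfrak{q}_w)$ for all $w\in\mathbf{W}(\mathcal{R})$, then the triple is of minimal type, i.e. every root $\alpha\in\mathcal{Q}^n$ with $\mathrm{s}(\alpha)\notin\mathcal{Q}$ satisfies $\mathrm{s}(\alpha)=-\alpha$.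
   Context: $\mathfrak{g}$ is a complex semisimple Lie algebra, $\sigma$ an anti-$\mathbb{C}$-linear involution, $\mathfrak{g}_\sigma$ its fixed-point real form, $\mathfrak{q}$ a parabolic subalgebra of $\mathfrak{g}$. A parabolic $CR$-triple $(\mathfrak{g}_\sigma,\mathfrak{q},\mathfrak{h}_\sigma)$ consists of such data and a Cartan subalgebra $\mathfrak{h}_\sigma$ of $\mathfrak{g}_\sigma$ contained in $\mathfrak{q}\cap\mathfrak{g}_\sigma$; $\mathfrak{h}$ is its complexification, $\mathfrak{g}^\alpha$ the root spaces. Since $\sigma(\mathfrak{h})=\mathfrak{h}$, $\sigma$ induces an involution $\mathrm{s}$ of $\mathcal{R}$ determined by $\sigma(\mathfrak{g}^\alpha)=\mathfrak{g}^{\mathrm{s}(\alpha)}$. $\mathcal{Q}^n=\{\alpha\in\mathcal{Q}\mid-\alpha\notin\mathcal{Q}\}$. For a complex subalgebra $\mathfrak{q}'$ of $\mathfrak{g}$, $\dim_\mathbb{R}(\mathfrak{g}_\sigma,\mathfrak{q}')=\dim_\mathbb{C}\mathfrak{g}-\dim_\mathbb{C}(\mathfrak{q}'\cap\sigma(\mathfrak{q}'))$ (the real dimension of the corresponding homogeneous $CR$-manifold). *)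

(* Defs.v *)
From HB Require Import structures.
From mathcomp Require Import all_boot all_order all_algebra.
From mathcomp Require Import complex.
From mathcomp Require Import reals.
Set Implicit Arguments. Unset Strict Implicit. Unset Printing Implicit Defensive.
Import Order.TTheory GRing.Theory Num.Theory.
Local Open Scope ring_scope.
Local Open Scope complex_scope.

Section LieDefs.
Variable R : realType.
Local Notation C := (R[i]).
Variable g : vectType C.
Variable br : g -> g -> g.

Definition lie_bracket : Prop :=
  [/\ (forall a x y z, br (a *: x + y) z = a *: br x z + br y z),
      (forall a x y z, br x (a *: y + z) = a *: br x y + br x z),
      (forall x, br x x = 0) &
      (forall x y z, br x (br y z) + br y (br z x) + br z (br x y) = 0)].

Definition subalgebra (U : {vspace g}) : Prop :=
  forall x y, x \in U -> y \in U -> br x y \in U.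

Definition lie_ideal (I : {vspace g}) : Prop :=
  forall x y, y \in I -> br x y \in I.

(* span of all brackets [u, v] with u in U, v in V (bracket is bilinear) *)
Definition brspace (U V : {vspace g}) : {vspace g} :=
  <<[seq br u v | u <- vbasis U, v <- vbasis V]>>%VS.

Definition derived (U : {vspace g}) : {vspace g} := brspace U U.

Definition solvable (U : {vspace g}) : Prop :=
  exists n, iter n derived U = 0%VS.

Definition semisimple : Prop :=
  forall I : {vspace g}, lie_ideal I -> solvable I -> I = 0%VS.

Definition borel (b : {vspace g}) : Prop :=
  [/\ subalgebra b, solvable b &
      forall b' : {vspace g}, subalgebra b' -> solvable b' -> (b <= b')%VS -> b' = b].

Definition parabolic (q : {vspace g}) : Prop :=
  subalgebra q /\ exists b, borel b /\ (b <= q)%VS.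

Variable sigma : g -> g.

Definition antilinear_involution : Prop :=
  [/\ (forall a x y, sigma (a *: x + y) = a^* *: sigma x + sigma y),
      (forall x, sigma (sigma x) = x) &
      (forall x y, sigma (br x y) = br (sigma x) (sigma y))].

(* sigma(U), a complex subspace since sigma is additive and antilinear *)
Definition sigma_img (U : {vspace g}) : {vspace g} := <<map sigma (vbasis U)>>%VS.

Definition iterbr (xs : seq g) (y : g) : g := foldr (fun x acc => br x acc) y xs.

(* h_sigma := {x in h | sigma x = x} is a Cartan subalgebra of the real Lie
   algebra g_sigma = {x | sigma x = x}: a nilpotent subalgebra equal to its
   normalizer in g_sigma. *)
Definition real_cartan_fixed (h : {vspace g}) : Prop :=
  let hs := fun x => (x \in h) /\ sigma x = x in
  [/\ (forall x y, hs x -> hs y -> hs (br x y)),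
      (exists n, forall xs : seq g, size xs = n -> (forall x, x \in xs -> hs x) ->
          forall y, hs y -> iterbr xs y = 0) &
      (forall x, sigma x = x -> (forall y, hs y -> hs (br x y)) -> hs x)].

Variable h : {vspace g}.

Definition hdual := 'Hom(subvs_of h, C^o).

Definition rootsp (alpha : hdual) : {vspace g} :=
  (\bigcap_(b <- vbasis h)
     lker (linfun (fun X : g => br b X - (alpha (vsproj h b) : C) *: X)))%VS.

Definition is_root (alpha : hdual) : bool :=
  (alpha != 0) && (rootsp alpha != 0%VS).

Definition is_coroot (alpha : hdual) (H : subvs_of h) : Prop :=
  vsval H \in brspace (rootsp alpha) (rootsp (- alpha)) /\ (alpha H : C) = 2.

Definition root_reflect (p : hdual * subvs_of h) (lambda : hdual) : hdual :=
  lambda - (lambda p.2 : C) *: p.1.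

(* Weyl group elements are represented as words in the root reflections *)
Definition weyl_word (ws : seq (hdual * subvs_of h)) : Prop :=
  forall p, p \in ws -> is_root p.1 /\ is_coroot p.1 p.2.

Definition weyl_act (ws : seq (hdual * subvs_of h)) (lambda : hdual) : hdual :=
  foldr root_reflect lambda ws.

(* q_w = h + sum_{beta in w(Q)} g^beta, with rs an enumeration of the roots *)
Definition q_w (q : {vspace g}) (rs : seq hdual) (ws : seq (hdual * subvs_of h))
  : {vspace g} :=
  (h + \sum_(a <- rs | (rootsp a <= q)%VS) rootsp (weyl_act ws a))%VS.

(* real dimension of the homogeneous CR manifold attached to (g_sigma, q') *)
Definition crdim (q' : {vspace g}) : nat :=
  (\dim {:g} - \dim (q' :&: sigma_img q'))%N.

End LieDefs.

(* Main.v *)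
Require Import Defs.
From HB Require Import structures.
From mathcomp Require Import all_boot all_order all_algebra.
From mathcomp Require Import complex reals.
From mathcomp Require Import boolp ring.
Set Implicit Arguments. Unset Strict Implicit. Unset Printing Implicit Defensive.
Import Order.TTheory.
Import GRing.Theory Num.Theory.
Local Open Scope ring_scope.

(* The set Q is closed and contains a or -a for each root a. The dimension of the
   CR manifold of q is a constant minus #(Q \cap s(Q)), so q minimizes it over
   the Weyl group iff #(wQ \cap s(wQ)) is maximal at w = 1.

   Exchange step: if c is a root with c in A and -c in B (A and B closed), then
   on each pair {x, r_c x} one of x, r_c x is at least as much in A, and the other
   one at least as much in B; by the rearrangement inequality
   #(A \cap r_c B) >= #(A \cap B), strictly if moreover -c is not in A and c is
   not in B. Suppose now a is in Q^n and b = s(a) is neither in Q nor equal to -a.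
   Then #(r_a Q \cap s(r_a Q)) = #(Q \cap r_a r_b s(Q)), and both reflections are
   exchange steps, the first one strict, as soon as r_a(-b) is in Q. Since s
   preserves the pairing, n = <b,a^v> = <a,b^v>; if n >= 0 then r_a(-b) is in Q
   since a and -b are, and otherwise n = -1 and r_a(-b) = -(a + b), which is in Q
   possibly after replacing (a,b) by (-b,-a).

   That Q contains a or -a follows from b^perp <= b for a Borel subalgebra b and
   the Killing form. The structure theory (Lie's theorem, Cartan's criterion,
   Cartan subalgebras, root strings) is obtained with traces on invariant
   subspaces, in the adjoint representation only. *)

(** * Traces of endomorphisms on invariant subspaces *)

(** The requirement r_a(-b) in Q is the hypothesis of the second exchange: there c = a, A = Q, B =
    r_b s(Q), and -a lies in B exactly when s(r_b(-a)) = r_a(-b) lies in Q. A negative n is at least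
    -1 because equal nonzero pairings force a and b to have equal length, and n <= -2 would give the
    root a + b a nonpositive square length. Quotient modules never appear. A statement on W/U is
    made about invariant subspaces U <= W: an eigenvector is an x in W outside U with f x - c x in
    U, and traces are compared on U and on W. Flags are mostly replaced by a subspace of extremal
    dimension with the wanted property. Jordan decompositions are replaced by polynomials in ad x
    found by Hermite interpolation, so that they preserve every subspace stable under ad x and
    commute with whatever commutes with ad x. *)

Section Trace.
Variables (F : fieldType) (V : vectType F).
Implicit Types (f g : 'End(V)) (U W : {vspace V}).

Definition ltr f : F :=
  \sum_(i < \dim {:V}) coord (vbasis {:V}) i (f (vbasis {:V})`_i).

Lemma ltr_is_linear : scalar ltr.
Proof.
move=> a f g; rewrite /ltr mulr_sumr -big_split; apply: eq_bigr => i _ /=.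
by rewrite add_lfunE scale_lfunE linearP.
Qed.
HB.instance Definition _ := GRing.isLinear.Build F 'End(V) F *%R ltr ltr_is_linear.

Lemma ltr_comp f g : ltr (f \o g)%VF = ltr (g \o f)%VF.
Proof.
have E (h k : 'End(V)) : ltr (h \o k)%VF =
    \sum_(i < \dim {:V}) \sum_(j < \dim {:V})
      coord (vbasis {:V}) j (k (vbasis {:V})`_i) *
      coord (vbasis {:V}) i (h (vbasis {:V})`_j).
  apply: eq_bigr => i _; rewrite comp_lfunE.
  rewrite {1}(coord_vbasis (memvf (k (vbasis {:V})`_i))) !linear_sum /=.
  by apply: eq_bigr => j _; rewrite !linearZ.
rewrite !E exchange_big; apply: eq_bigr => i _; apply: eq_bigr => j _.
exact: mulrC.
Qed.

(** When f preserves U this is the trace of the restriction; composing with a projection keeps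
    everything inside ['End(V)]. *)
Definition trv U f : F := ltr (f \o projv U)%VF.

Lemma trv_is_linear U : scalar (trv U).
Proof.
by move=> a f g; rewrite /trv comp_lfunDl -comp_lfunZl linearP.
Qed.
HB.instance Definition _ U :=
  GRing.isLinear.Build F 'End(V) F *%R (trv U) (trv_is_linear U).

Lemma trv_full f : trv fullv f = ltr f.
Proof.
rewrite /trv; congr ltr; apply/lfunP => v.
by rewrite comp_lfunE projv_id ?memvf.
Qed.

(** Since f maps W into U, f p_W = p_U f p_W, and by cyclicity its trace is that of f p_W p_U = f
    p_U. *)
Lemma trv_sub U W f : (U <= W)%VS -> (forall w, w \in W -> f w \in U) ->
  trv W f = trv U f.
Proof.
move=> UW fWU; rewrite /trv.
have -> : (f \o projv W = projv U \o (f \o projv W))%VF.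
  apply/lfunP => v; rewrite !comp_lfunE [projv U _]projv_id //.
  exact: fWU _ (memv_proj _ _).
rewrite [LHS]ltr_comp; congr ltr; apply/lfunP => v; rewrite !comp_lfunE.
by rewrite [projv W _]projv_id //; apply: (subvP UW) _ (memv_proj _ _).

Qed.

Lemma trv_comm U f g : (forall u, u \in U -> f u \in U) ->
  (forall u, u \in U -> g u \in U) -> trv U (f \o g)%VF = trv U (g \o f)%VF.
Proof.
move=> fU gU; rewrite /trv.
have E (h k : 'End(V)) : (forall u, u \in U -> k u \in U) ->
    ((h \o k) \o projv U = (h \o projv U) \o (k \o projv U))%VF.
  move=> kU; apply/lfunP => v; rewrite !comp_lfunE [projv U (k _)]projv_id //.
  exact: kU _ (memv_proj _ _).
by rewrite !E // ltr_comp.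
Qed.

(** One double sum mixes a basis of V with a basis of U; exchanging it turns the trace of the
    projection into the trace of the identity of U. *)
Lemma trv_id U : trv U \1%VF = (\dim U)%:R.
Proof.
rewrite /trv comp_lfun1l.
have -> : (\dim U)%:R = \sum_(i < \dim U) coord (vbasis U) i (vbasis U)`_i :> F.
  rewrite (eq_bigr (fun=> 1)) => [|i _].
    by rewrite sumr_const card_ord.
  by rewrite coord_free ?(basis_free (vbasisP U)) // eqxx.
pose X := vbasis {:V}; pose Y := vbasis U.
have -> : ltr (projv U) = \sum_(i < \dim {:V}) \sum_(j < \dim U)
     coord Y j (projv U X`_i) * coord X i Y`_j.
  apply: eq_bigr => i _.
  rewrite {1}(coord_vbasis (memv_proj U X`_i)) linear_sum /=.
  by apply: eq_bigr => j _; rewrite linearZ.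
rewrite exchange_big; apply: eq_bigr => j _ /=.
have Yj : Y`_j \in U by apply/vbasis_mem/mem_nth; rewrite size_tuple.
transitivity (coord Y j (projv U Y`_j)); last by rewrite projv_id.
rewrite [X in projv U X](coord_vbasis (memvf Y`_j)) !linear_sum /=.
by apply: eq_bigr => i _; rewrite !linearZ mulrC.
Qed.

(** Here f acts on W/U as the scalar c, so [trv_sub] applies to f - c. *)
Lemma trv_quot U W f c : (U <= W)%VS ->
    (forall w, w \in W -> f w - c *: w \in U) ->
  trv W f = trv U f + c * (\dim W - \dim U)%:R.
Proof.
move=> UW fc; have := trv_sub (f := f - c *: \1%VF) UW.
rewrite !linearB !linearZ /= !trv_id natrB ?dimvS // mulrBr => e.
have {e} : trv W f - c * (\dim W)%:R = trv U f - c * (\dim U)%:R.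
  apply: e => w wW; rewrite add_lfunE scale_lfunE opp_lfunE id_lfunE scalerN.
  exact: fc.
  by move=> /eqP; rewrite subr_eq => /eqP ->; rewrite -addrA [- _ + _]addrC.
Qed.

Lemma trv0 f : trv 0 f = 0.
Proof.
rewrite /trv (_ : (f \o projv 0)%VF = 0) ?linear0 //.
apply/lfunP => v; rewrite comp_lfunE zero_lfunE.
by have := memv_proj 0 v; rewrite memv0 => /eqP ->; rewrite linear0.
Qed.

(** Passing from U to its image f(U) keeps the trace and lowers the exponent by one. *)
Lemma trv_nilp U f k : (forall u, u \in U -> f u \in U) ->
  (forall u, u \in U -> iter k f u = 0) -> trv U f = 0.
Proof.
elim: k U => [|k IHk] U fU fk.
  suff -> : U = 0%VS by exact: trv0.
  apply/eqP; rewrite -subv0; apply/subvP => u /fk /= ->; exact: mem0v.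
have sub : (f @: U <= U)%VS by apply/subvP => _ /memv_imgP[u uU ->]; exact: fU.
rewrite (trv_sub sub) => [|w wU]; last exact: memv_img.
apply: IHk => [u /(subvP sub)/(memv_img f) //|_ /memv_imgP[u uU ->]].
by rewrite -iterSr fk.
Qed.

Lemma trv_addv U W f c : (U :&: W = 0)%VS -> (forall u, u \in U -> f u \in U) ->
  (forall w, w \in W -> f w = c *: w) ->
  trv (U + W) f = trv U f + c * (\dim W)%:R.
Proof.
move=> UW0 fU fW; rewrite (@trv_quot U (U + W) f c) ?addvSl //.
  by rewrite dimv_disjoint_sum // addKn.
move=> _ /memv_addP[u uU [w wW ->]].
rewrite [f _]linearD /= scalerDr (fW w) // opprD addrACA subrr addr0.
by rewrite rpredB ?fU ?rpredZ.
Qed.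

End Trace.

(** * Polynomials in an endomorphism *)

Section PolynomialAction.
Variables (F : fieldType) (V : vectType F).
Implicit Types (f : 'End(V)) (p q : {poly F}) (U W : {vspace V}).

Definition lpow f n : 'End(V) := iter n (comp_lfun f) \1%VF.

Lemma lpowE f n v : lpow f n v = iter n f v.
Proof. by elim: n => [|n IHn]; rewrite /= ?id_lfunE // comp_lfunE IHn. Qed.

Definition lhorner f p : 'End(V) := \sum_(i < size p) p`_i *: lpow f i.

Lemma lhorner_wide f p n : (size p <= n)%N ->
  lhorner f p = \sum_(i < n) p`_i *: lpow f i.
Proof.
move=> le_pn; rewrite /lhorner (big_ord_widen n (fun i => p`_i *: lpow f i)) //.
rewrite big_mkcond; apply: eq_bigr => i _; case: ltnP => // le_pi.
by rewrite nth_default // scale0r.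
Qed.

Lemma lhorner_is_linear f : linear (lhorner f).
Proof.
move=> a p q; pose n := maxn (size p) (size q).
rewrite (@lhorner_wide f (a *: p + q) n); last first.
  by rewrite (leq_trans (size_polyD _ _)) // geq_max !leq_max size_scale_leq leqnn !orbT.
rewrite (@lhorner_wide f p n) ?leq_maxl // (@lhorner_wide f q n) ?leq_maxr //.
rewrite scaler_sumr -big_split; apply: eq_bigr => i _ /=.
by rewrite coefD coefZ scalerDl scalerA.
Qed.
HB.instance Definition _ f :=
  GRing.isLinear.Build F {poly F} 'End(V) _ (lhorner f) (lhorner_is_linear f).

Lemma lhornerC f c v : lhorner f c%:P v = c *: v.
Proof.
rewrite (@lhorner_wide f _ 1) ?size_polyC ?leq_b1 // big_ord1 coefC eqxx.
by rewrite scale_lfunE lpowE.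
Qed.

Lemma lhornerMX f p v : lhorner f (p * 'X) v = f (lhorner f p v).
Proof.
rewrite (@lhorner_wide f _ (size p).+1); last first.
  by have [->|p0] := eqVneq p 0; rewrite ?mul0r ?size_poly0 // size_mulX.
rewrite big_ord_recl coefMX eqxx scale0r add0r !sum_lfunE linear_sum /=.
by apply: eq_bigr => i _; rewrite coefMX /= !scale_lfunE linearZ /= comp_lfunE.
Qed.

Lemma lhornerM f p q v : lhorner f (p * q) v = lhorner f p (lhorner f q v).
Proof.
elim/poly_ind: p v => [|p c IHp] v; first by rewrite mul0r linear0 !zero_lfunE.
rewrite mulrDl !linearD /= !add_lfunE mul_polyC linearZ /= scale_lfunE lhornerC.
by rewrite -mulrA [_ * q]mulrC mulrA !lhornerMX IHp.
Qed.

Lemma lhornerX f v : lhorner f 'X v = f v.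
Proof. by rewrite -['X]mul1r lhornerMX lhornerC scale1r. Qed.

Lemma lhornerXsubC f c v : lhorner f ('X - c%:P) v = f v - c *: v.
Proof. by rewrite linearB /= add_lfunE opp_lfunE lhornerX lhornerC. Qed.

Lemma lhorner_stable f p U : (forall u, u \in U -> f u \in U) ->
  forall u, u \in U -> lhorner f p u \in U.
Proof.
move=> fU u uU; rewrite sum_lfunE rpred_sum // => i _.
rewrite scale_lfunE rpredZ // lpowE.
by elim: (nat_of_ord i) => //= n; apply: fU.
Qed.

Lemma lhorner_commute f (h : 'End(V)) p : (forall v, h (f v) = f (h v)) ->
  forall v, h (lhorner f p v) = lhorner f p (h v).
Proof.
move=> fh v; rewrite !sum_lfunE linear_sum; apply: eq_bigr => i _ /=.
rewrite !scale_lfunE linearZ !lpowE /=; congr (_ *: _).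
by elim: (nat_of_ord i) => //= n <-.
Qed.

Lemma lhorner_dvd0 f p q v : p %| q -> lhorner f p v = 0 -> lhorner f q v = 0.
Proof. by move=> /dvdpP[r ->] e; rewrite lhornerM e linear0. Qed.

(** X - c divides p - p(c). *)
Lemma lhorner_eigenmod f p U x c : (forall u, u \in U -> f u \in U) ->
  f x - c *: x \in U -> lhorner f p x - p.[c] *: x \in U.
Proof.
move=> fU fx.
have /dvdpP[r Er] : 'X - c%:P %| p - (p.[c])%:P.
  by rewrite -root_factor_theorem rootE !hornerE subrr.
have -> : lhorner f p x - p.[c] *: x = lhorner f (p - (p.[c])%:P) x.
  by rewrite linearB /= add_lfunE opp_lfunE lhornerC.
by rewrite Er lhornerM lhornerXsubC; apply: lhorner_stable.
Qed.

(** Chinese remainders, one node at a time: with P the product of the powers already treated and u P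
    + v (X - c)^N = 1, the polynomial u P is 1 at the new node and 0 at the old ones, to order N. *)
Lemma hermite_interp (phi : F -> F) N (s : seq F) : uniq s ->
  exists p : {poly F}, forall c, c \in s -> ('X - c%:P) ^+ N %| p - (phi c)%:P.
Proof.
elim: s => [_|c s IHs /= /andP[cs us]]; first by exists 0.
have [p Hp] := IHs us.
pose P := \prod_(d <- s) ('X - d%:P) ^+ N.
have : coprimep P (('X - c%:P) ^+ N).
  rewrite /P big_seq; elim/big_rec: _ => [|d x ds cx]; first exact: coprime1p.
  rewrite coprimepMl cx andbT coprimep_expl // coprimep_expr //.
  by rewrite coprimep_XsubC root_XsubC; apply: contraNneq cs => ->.
case/Bezout_eq1_coprimepP => -[u v] /= uv.
exists (p + u * P * ((phi c)%:P - p)) => d.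
rewrite inE => /orP[/eqP->|ds].
  have -> : p + u * P * ((phi c)%:P - p) - (phi c)%:P
            = - (1 - u * P) * ((phi c)%:P - p).
    by rewrite mulNr mulrBl mul1r opprB [LHS]addrAC addrC opprB.
  by rewrite -uv addrAC subrr add0r mulNr dvdpNr mulrAC dvdp_mull.
have -> : p + u * P * ((phi c)%:P - p) - (phi d)%:P
   = p - (phi d)%:P + u * P * ((phi c)%:P - p) by rewrite addrAC.
rewrite dvdp_add ?Hp // dvdp_mulr // dvdp_mull //.
by rewrite /P (big_rem d) //= dvdp_mulr.
Qed.

Lemma dvdp_prod_coprime (r : {poly F}) N (s : seq F) : uniq s ->
  (forall c, c \in s -> ('X - c%:P) ^+ N %| r) ->
  \prod_(c <- s) ('X - c%:P) ^+ N %| r.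
Proof.
elim: s => [_ _|c s IHs /= /andP[cs us] H]; first by rewrite big_nil dvd1p.
rewrite big_cons Gauss_dvdp ?H ?mem_head ?IHs // => [d ds|].
  by apply: H; rewrite inE ds orbT.
rewrite big_seq; elim/big_rec: _ => [|d x ds cx]; first exact: coprimep1.
rewrite coprimepMr cx andbT coprimep_expl // coprimep_expr //.
by rewrite coprimep_XsubC root_XsubC; apply: contraNneq cs => <-.
Qed.

End PolynomialAction.

(** * Annihilating polynomials and eigenvectors over a closed field *)

Section ClosedField.
Variables (F : closedFieldType) (V : vectType F).
Implicit Types (f : 'End(V)) (U W : {vspace V}).

(** The powers of f are linearly dependent once they outnumber the dimension of ['End(V)]. The
    polynomial is not claimed to be minimal: [cs] may contain scalars that are not eigenvalues. *)
Lemma annihilating_roots f :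
  exists cs : seq F, lhorner f (\prod_(c <- cs) ('X - c%:P)) = 0.
Proof.
pose N := (\dim {: 'End(V)}).+1.
pose X := [tuple lpow f i | i < N].
have nfX : ~~ free X.
  rewrite /free size_tuple neq_ltn; apply/orP; left.
  by rewrite ltnS; apply/dimvS/subvf.
have [k /existsNP[i0 /eqP ki0] Sk] :
    exists2 k : 'I_N -> F, ~ (forall i, k i = 0) & \sum_(i < N) k i *: X`_i = 0.
  apply: contrapT => H; move/negP: nfX; apply; apply/freeP => k Sk.
  by apply: contrapT => nk; apply: H; exists k.
pose p := \poly_(i < N) k (inord i).
have pk (i : 'I_N) : p`_i = k i by rewrite coef_poly ltn_ord inord_val.
have p0 : p != 0.
  by apply: contra_neq ki0 => p0; rewrite -pk p0 coef0.
have fp : lhorner f p = 0.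
  rewrite (@lhorner_wide _ _ f p N) ?size_poly // -[RHS]Sk.
  by apply: eq_bigr => i _; rewrite pk -tnth_nth tnth_mktuple.
have [cs Ep] := closed_field_poly_normal p; exists cs.
have /eqP : lead_coef p *: lhorner f (\prod_(c <- cs) ('X - c%:P)) = 0.
  by rewrite -linearZ /= -Ep.
by rewrite scaler_eq0 lead_coef_eq0 (negPf p0) => /eqP.
Qed.

(** Apply the factors X - c to x one after the other: the last vector outside U before the product
    falls into U is the eigenvector. *)
Lemma eigenvector_mod f cs U W :
    lhorner f (\prod_(c <- cs) ('X - c%:P)) = 0 ->
    (U <= W)%VS -> U != W -> (forall u, u \in U -> f u \in U) ->
    (forall w, w \in W -> f w \in W) ->
  exists x c, [/\ x \in W, x \notin U, c \in cs & f x - c *: x \in U].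
Proof.
move=> f0 UW nUW fU fW.
have [x xW xU] : exists2 x, x \in W & x \notin U.
  by apply/subvPn; apply: contra nUW => WU; rewrite eqEsubv UW.
have : lhorner f (\prod_(c <- cs) ('X - c%:P)) x \in U.
  by rewrite f0 zero_lfunE mem0v.
elim: cs x xW xU {f0} => [|c cs IHcs] x xW xU.
  by rewrite big_nil lhornerC scale1r (negPf xU).
rewrite big_cons mulrC lhornerM lhornerXsubC => H.
have [yU|yU] := boolP (f x - c *: x \in U).
  by exists x, c; rewrite xW xU mem_head.
have [|y [d [yW yU' dcs fy]]] := IHcs _ _ yU H.
  by rewrite rpredB ?fW ?rpredZ.
by exists y, d; rewrite yW yU' inE dcs orbT.
Qed.

End ClosedField.

(** * Subspaces *)

Section Subspaces.
Variables (F : fieldType) (V : vectType F).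
Implicit Types (U W : {vspace V}).

(** [lfunE] wants a bundled linear map, while a bracket only comes with a proof of linearity; the
    bundle is made here. *)
Lemma linfun_linearE (V' : vectType F) (f : V -> V') : linear f -> linfun f =1 f.
Proof.
move=> lf; pose m := GRing.isLinear.Build F V V' _ f lf.
pose f' : {linear V -> V'} := HB.pack f m.
exact: (lfunE f').
Qed.

Lemma span_scalar0 (f : V -> F) X : scalar f ->
  (forall v, v \in X -> f v = 0) -> forall v, v \in <<X>>%VS -> f v = 0.
Proof.
move=> lf fX v; pose m := GRing.isLinear.Build F V F _ f lf.
pose f' : {scalar V} := HB.pack f m.
move=> /(@coord_span _ _ _ (in_tuple X)) ev; have -> : f v = f' v by [].
rewrite ev linear_sum big1 // => i _.
by rewrite linearZ /= fX ?mulr0 // mem_nth.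
Qed.

Lemma ex_max_dim (P : {vspace V} -> Prop) U0 : P U0 ->
  exists2 U, P U & forall U', P U' -> (\dim U' <= \dim U)%N.
Proof.
move=> PU0; pose Q n := `[< exists2 U, P U & \dim U = n >].
have exQ : exists n, Q n by exists (\dim U0); apply/asboolP; exists U0.
have ubQ n : Q n -> (n <= \dim {:V})%N.
  by move=> /asboolP[U _ <-]; apply/dimvS/subvf.
case: (ex_maxnP exQ ubQ) => n /asboolP[U PU <-] H; exists U => // U' PU'.
by apply: H; apply/asboolP; exists U'.
Qed.

Lemma ex_min_dim (P : {vspace V} -> Prop) U0 : P U0 ->
  exists2 U, P U & forall U', P U' -> (\dim U <= \dim U')%N.
Proof.
move=> PU0; pose Q n := `[< exists2 U, P U & \dim U = n >].
have exQ : exists n, Q n by exists (\dim U0); apply/asboolP; exists U0.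
case: (ex_minnP exQ) => n /asboolP[U PU <-] H; exists U => // U' PU'.
by apply: H; apply/asboolP; exists U'.
Qed.

(** With U the derived algebra of W, such an H is an ideal of codimension 1, the induction step of
    Lie's theorem. *)
Lemma hyperplane_between U W : (U <= W)%VS -> U != W ->
  exists H z, [/\ (U <= H)%VS, z \in W, z \notin H & W = (H + <[z]>)%VS].
Proof.
move=> UW nUW.
have [z zW zU] : exists2 x, x \in W & x \notin U.
  by apply/subvPn; apply: contra nUW => WU; rewrite eqEsubv UW.
have XW : (U + <[z]> <= W)%VS by rewrite subv_add UW -memvE.
exists (U + (W :\: (U + <[z]>)))%VS, z; split=> //; first exact: addvSl.
- apply: contra zU => /memv_addP[u uU [d dD ez]].
  suff : d \in ((W :\: (U + <[z]>)) :&: (U + <[z]>))%VS.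
    by rewrite capv_diff memv0 ez => /eqP ->; rewrite addr0.
  rewrite memv_cap dD (_ : d = - u + z); last by rewrite ez addKr.
  by rewrite memv_add ?memvN ?memv_line.
- by rewrite -{1}(addv_diff_cap W (U + <[z]>)) (capv_idPr XW) addvA [(_ + U)%VS]addvC.
Qed.

Lemma dimv_add_line U z : z \notin U -> \dim (U + <[z]>) = (\dim U).+1.
Proof.
move=> zU; rewrite dimv_disjoint_sum ?dim_vline.
  by rewrite (_ : z != 0) ?addn1 //; apply: contraNneq zU => ->; apply: mem0v.
apply/eqP; rewrite -subv0; apply/subvP => w /memv_capP[wU /vlineP[k Ek]].
rewrite Ek in wU *; rewrite memv0; have [->|k0] := eqVneq k 0; first by rewrite scale0r.
by case/negP: zU; rewrite -[z](scalerK k0) rpredZ.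
Qed.

End Subspaces.

(** * Lie's theorem *)

Section LieAlgebra.
Variables (R : realType) (g : vectType R[i]) (br : g -> g -> g).
Hypothesis lieP : lie_bracket br.
Implicit Types (x y z u v w : g) (U W p : {vspace g}).
Local Notation C := R[i].

Lemma br_linear_r x : linear (br x).
Proof. by case: lieP => _ H _ _ a y z; apply: H. Qed.

Lemma br_linear_l y : linear (br^~ y).
Proof. by case: lieP => H _ _ _ a x z; apply: H. Qed.

Definition ad x : 'End(g) := linfun (br x).

Lemma adE x y : ad x y = br x y.
Proof. exact/linfun_linearE/br_linear_r. Qed.

Lemma ad_is_linear : linear ad.
Proof.
move=> a x y; apply/lfunP => z; rewrite add_lfunE scale_lfunE !adE.
exact: br_linear_l.
Qed.
HB.instance Definition _ :=
  GRing.isLinear.Build C g 'End(g) _ ad ad_is_linear.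

Lemma brDl x y z : br (x + y) z = br x z + br y z.
Proof. by rewrite -!adE linearD add_lfunE. Qed.
Lemma brDr x y z : br x (y + z) = br x y + br x z.
Proof. by rewrite -!adE linearD. Qed.
Lemma brZl a x y : br (a *: x) y = a *: br x y.
Proof. by rewrite -!adE linearZ scale_lfunE. Qed.
Lemma brZr a x y : br x (a *: y) = a *: br x y.
Proof. by rewrite -!adE linearZ. Qed.
Lemma brNl x y : br (- x) y = - br x y.
Proof. by rewrite -!adE linearN opp_lfunE. Qed.
Lemma brNr x y : br x (- y) = - br x y.
Proof. by rewrite -!adE linearN. Qed.
Lemma brBl x y z : br (x - y) z = br x z - br y z.
Proof. by rewrite brDl brNl. Qed.
Lemma brBr x y z : br x (y - z) = br x y - br x z.
Proof. by rewrite brDr brNr. Qed.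
Lemma br0l x : br 0 x = 0.
Proof. by rewrite -adE linear0 zero_lfunE. Qed.
Lemma br0r x : br x 0 = 0.
Proof. by rewrite -adE linear0. Qed.
Lemma brxx x : br x x = 0.
Proof. by case: lieP. Qed.
Lemma brC x y : br x y = - br y x.
Proof.
apply/eqP; rewrite -addr_eq0; apply/eqP.
by have := brxx (x + y); rewrite brDl !brDr !brxx add0r addr0.
Qed.
Lemma br_jacobi x y z : br x (br y z) = br (br x y) z + br y (br x z).
Proof.
have [_ _ _ J] := lieP; apply/eqP; rewrite -subr_eq0; apply/eqP.
rewrite [br (br x y) z]brC [br x z]brC brNr -opprD opprK.
by rewrite [br z _ + _]addrC addrA J.
Qed.
Lemma brA x y z : br (br x y) z = br x (br y z) - br y (br x z).
Proof. by rewrite br_jacobi addrK. Qed.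

Lemma ad_br x y : ad (br x y) = ((ad x \o ad y) - (ad y \o ad x))%VF.
Proof.
by apply/lfunP => z; rewrite add_lfunE opp_lfunE !comp_lfunE !adE brA.
Qed.

(** * The Killing form *)

Definition kappa x y : C := ltr (ad x \o ad y)%VF.

Lemma kappaC x y : kappa x y = kappa y x.
Proof. exact: ltr_comp. Qed.

Lemma kappa_linear_r x : scalar (kappa x).
Proof. by move=> a y z; rewrite /kappa linearP /= comp_lfunDr -comp_lfunZr linearP. Qed.
HB.instance Definition _ x :=
  GRing.isLinear.Build C g C *%R (kappa x) (kappa_linear_r x).

Lemma kappaDr x y z : kappa x (y + z) = kappa x y + kappa x z.
Proof. exact: linearD. Qed.
Lemma kappaNr x y : kappa x (- y) = - kappa x y.
Proof. exact: linearN. Qed.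
Lemma kappaZr a x y : kappa x (a *: y) = a * kappa x y.
Proof. exact: linearZ. Qed.
Lemma kappa0r x : kappa x 0 = 0.
Proof. exact: linear0. Qed.
Lemma kappaDl x y z : kappa (x + y) z = kappa x z + kappa y z.
Proof. by rewrite !(kappaC _ z) linearD. Qed.
Lemma kappaNl x y : kappa (- x) y = - kappa x y.
Proof. by rewrite !(kappaC _ y) linearN. Qed.
Lemma kappaZl a x y : kappa (a *: x) y = a * kappa x y.
Proof. by rewrite !(kappaC _ y) linearZ. Qed.
Lemma kappa0l x : kappa 0 x = 0.
Proof. by rewrite (kappaC _ x) linear0. Qed.

Lemma kappa_br x y z : kappa (br x y) z = kappa x (br y z).
Proof.
rewrite /kappa !ad_br comp_lfunDl comp_lfunDr comp_lfunNl comp_lfunNr !linearB /=.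
rewrite -!comp_lfunA; congr (_ - _).
by rewrite [LHS]ltr_comp comp_lfunA.
Qed.

Definition stable p U := forall y u, y \in p -> u \in U -> br y u \in U.

Lemma stable_add p U W : stable p U -> stable p W -> stable p (U + W).
Proof.
move=> sU sW y _ yp /memv_addP[u uU [w wW ->]].
by rewrite brDr memv_add ?sU ?sW.
Qed.

Lemma mem_brspace U W u w : u \in U -> w \in W -> br u w \in brspace br U W.
Proof.
move=> uU wW; rewrite (coord_vbasis uU) (coord_vbasis wW) -adE linear_sum /=.
rewrite rpred_sum // => j _; rewrite linear_sum sum_lfunE rpred_sum // => i _.
rewrite !linearZ /= scale_lfunE !rpredZ // adE; apply: memv_span.
by apply: allpairs_f; rewrite mem_nth // size_tuple.
Qed.

Lemma brspace_subv U W (X : {vspace g}) : (forall u w, u \in U -> w \in W -> br u w \in X) ->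
  (brspace br U W <= X)%VS.
Proof.
move=> H; apply/span_subvP => _ /allpairsP[[u w] /= [uU wW ->]].
by apply: H; apply: vbasis_mem.
Qed.

Lemma brspaceS U U' W W' : (U <= U')%VS -> (W <= W')%VS ->
  (brspace br U W <= brspace br U' W')%VS.
Proof.
move=> UU WW; apply: brspace_subv => u w /(subvP UU) uU /(subvP WW).
exact: mem_brspace.
Qed.

Lemma solvableS U W : (U <= W)%VS -> solvable br W -> solvable br U.
Proof.
move=> UW [n Wn]; exists n; apply/eqP; rewrite -subv0 -Wn.
by elim: n {Wn} => //= n IHn; apply: brspaceS.
Qed.

Lemma solvable_derived U : solvable br (derived br U) -> solvable br U.
Proof. by case=> n Un; exists n.+1; rewrite iterSr. Qed.

Lemma derived_subv p : subalgebra br p -> (derived br p <= p)%VS.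
Proof. by move=> sp; apply: brspace_subv. Qed.

Lemma subalgebra_between p U : subalgebra br p ->
  (derived br p <= U)%VS -> (U <= p)%VS -> subalgebra br U.
Proof.
move=> sp dU Up x y /(subvP Up) xp /(subvP Up) yp.
by apply: (subvP dU); apply: mem_brspace.
Qed.

Lemma solvable_derived_neq p : solvable br p -> p != 0%VS -> derived br p != p.
Proof.
case=> n pn; apply: contra_neq => e; rewrite -pn.
by elim: n {pn} => //= n <-.
Qed.

(** Lie's theorem for the module W/U. An ideal H of codimension 1 has a common eigenvector x1 modulo
    U by induction; the iterates of x1 under a complementary z span, modulo U, a space on which H
    acts by the scalars [lam], and z has an eigenvector there. *)
Lemma lie_theorem p U W : subalgebra br p -> solvable br p ->
    (U <= W)%VS -> U != W -> stable p U -> stable p W ->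
  exists x (lam : g -> C), [/\ x \in W, x \notin U &
    forall y, y \in p -> br y x - lam y *: x \in U].
Proof.
have [n] := ubnP (\dim p); elim: n p U W => // n IHn p U W.
rewrite ltnS => dp sp solp UW nUW pU pW.
have [x0 x0W x0U] : exists2 x, x \in W & x \notin U.
  by apply/subvPn; apply: contra nUW => WU; rewrite eqEsubv UW.
have [p0|p_neq0] := eqVneq p 0%VS.
  exists x0, (fun=> 0); split=> // y; rewrite p0 memv0 => /eqP ->.
  by rewrite br0l scale0r subrr mem0v.
have [H [z [dH zp zH defp]]] :=
  hyperplane_between (derived_subv sp) (solvable_derived_neq solp p_neq0).
have Hp : (H <= p)%VS by rewrite defp addvSl.
have brH y y' : y \in p -> y' \in p -> br y y' \in H.
  by move=> yp yp'; apply: (subvP dH); apply: mem_brspace.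
have sH : subalgebra br H := subalgebra_between sp dH Hp.
have [|||x1 [lam [x1W x1U x1lam]]] :=
  IHn H U W _ sH (solvableS Hp solp) UW nUW _ _.
- by rewrite (leq_trans _ dp) // defp dimv_add_line.
- by move=> y u /(subvP Hp); apply: pU.
- by move=> y u /(subvP Hp); apply: pW.
clear x0 x0W x0U.
pose xk k := iter k (br z) x1.
(* H is triangular on this flag, with diagonal [lam]. *)
pose Y k := (U + <<mkseq xk k>>)%VS.
have YS k : Y k.+1 = (Y k + <[xk k]>)%VS.
  by rewrite /Y /mkseq -addn1 iotaD map_cat span_cat span_seq1 addvA.
have zY k y : y \in Y k -> br z y \in Y k.+1.
  elim: k y => [|k IHk] y.
    rewrite /Y /= span_nil addv0 => yU; apply: (subvP (addvSl _ _)).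
    exact: pU.
  rewrite YS => /memv_addP[w wY [_ /vlineP[a ->] ->]].
  rewrite brDr brZr YS memv_add ?IHk // rpredZ //; exact: memv_line.
have YmonoS k : (Y k <= Y k.+1)%VS by rewrite YS addvSl.
have xY k : xk k \in Y k.+1 by rewrite YS (subvP (addvSr _ _)) ?memv_line.
have HY k y : y \in H -> br y (xk k) - lam y *: xk k \in Y k.
  elim: k y => [|k IHk] y yH.
    by rewrite /Y span_nil addv0 x1lam.
  have yp := subvP Hp _ yH.
  have -> : br y (xk k.+1) - lam y *: xk k.+1 =
     (br (br y z) (xk k) - lam (br y z) *: xk k) + lam (br y z) *: xk k
     + br z (br y (xk k) - lam y *: xk k).
    by rewrite subrK /= br_jacobi brBr brZr addrA.
  rewrite rpredD ?zY ?IHk // rpredD ?rpredZ ?xY //.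
  by apply: (subvP (YmonoS _)); apply: IHk; apply: brH.
have HYst k y w : y \in H -> w \in Y k -> br y w \in Y k.
  move=> yH; elim: k w => [|k IHk] w.
    by rewrite /Y span_nil addv0; apply/pU/(subvP Hp).
  rewrite YS => /memv_addP[w' w'Y [_ /vlineP[a ->] ->]].
  rewrite brDr brZr -[br y (xk k)](subrK (lam y *: xk k)) -YS.
  apply: rpredD; first exact: (subvP (YmonoS k)) _ (IHk _ w'Y).
  apply/rpredZ/rpredD; first exact: (subvP (YmonoS k)) _ (HY k y yH).
  by rewrite rpredZ ?xY.
(* The dimension grows by one at each step until the first such m; [Y m] is then stable under z, of
   dimension exactly dim U + m. *)
have exm : exists m, xk m \in Y m.
  apply: contrapT => nm.
  have dY k : \dim (Y k) = (\dim U + k)%N.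
    elim: k => [|k IHk]; first by rewrite /Y span_nil addv0 addn0.
    by rewrite YS dimv_add_line ?IHk ?addnS //; apply/negP => H'; apply: nm; exists k.
  have := dimvS (subvf (Y (\dim {:g}).+1)).
  by rewrite dY addnS leqNgt ltnS leq_addl.
case: (ex_minnP exm) => m xm minm {exm}.
have dY k : (k <= m)%N -> \dim (Y k) = (\dim U + k)%N.
  elim: k => [|k IHk] km; first by rewrite /Y span_nil addv0 addn0.
  rewrite YS dimv_add_line ?IHk ?addnS // 1?ltnW //.
  by apply/negP => /minm; rewrite leqNgt km.
have m_gt0 : (0 < m)%N.
  by case: (m) xm => //; rewrite /Y span_nil addv0 (negPf x1U).
have UY : (U <= Y m)%VS by apply: addvSl.
have zYm y : y \in Y m -> br z y \in Y m.
  by move=> /zY; rewrite YS (addv_idPl _) // -memvE.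
(* The commutator [z, y] has trace 0 both on U and on [Y m], and these traces differ by m
   lam([z, y]); conclude by characteristic 0. *)
have lam0 y : y \in H -> lam (br z y) = 0.
  move=> yH; set v := br z y.
  have yp := subvP Hp _ yH.
  have vH : v \in H by apply: brH.
  have tr0 (T : {vspace g}) : (forall u, u \in T -> br z u \in T) ->
      (forall u, u \in T -> br y u \in T) -> trv T (ad v) = 0.
    move=> zT yT; rewrite /v ad_br linearB /= trv_comm ?subrr // => u uT.
      by rewrite adE zT.
    by rewrite adE yT.
  have trY k : (k <= m)%N -> trv (Y k) (ad v) = trv U (ad v) + lam v * k%:R.
    elim: k => [|k IHk] km; first by rewrite /Y span_nil addv0 mulr0 addr0.
    rewrite (@trv_quot _ _ (Y k) _ _ (lam v)) //.
      rewrite IHk 1?ltnW // !dY // 1?ltnW // addnS subSn // subnn.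
      by rewrite -addrA -mulrDr -natrD addn1.
    move=> w; rewrite YS => /memv_addP[w' w'Y [_ /vlineP[a ->] ->]].
    rewrite adE brDr scalerDr opprD addrACA brZr scalerA mulrC -scalerA -scalerBr.
    by rewrite rpredD ?rpredB ?rpredZ ?HYst ?HY.
  have := trY m (leqnn m); rewrite !tr0 //.
  - move/esym/eqP; rewrite add0r mulf_eq0 pnatr_eq0 eqn0Ngt m_gt0 orbF.
    by move/eqP.
  - by move=> u; apply: pU.
  - by move=> u; apply: pU.
  - by move=> u; apply: HYst.
have HU k y : y \in H -> br y (xk k) - lam y *: xk k \in U.
  elim: k y => [|k IHk] y yH; first exact: x1lam.
  have yp := subvP Hp _ yH.
  have l0 : lam (br y z) = 0 by rewrite brC -brNr lam0 ?rpredN.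
  have -> : br y (xk k.+1) - lam y *: xk k.+1 =
     (br (br y z) (xk k) - lam (br y z) *: xk k)
     + br z (br y (xk k) - lam y *: xk k).
    by rewrite l0 scale0r subr0 /= br_jacobi brBr brZr addrA.
  by rewrite rpredD ?IHk ?brH ?pU ?IHk.
have HUY k y w : y \in H -> w \in Y k -> br y w - lam y *: w \in U.
  move=> yH; elim: k w => [|k IHk] w.
    rewrite /Y span_nil addv0 => wU; rewrite rpredB ?rpredZ //.
    by apply: pU => //; apply: (subvP Hp).
  rewrite YS => /memv_addP[w' w'Y [_ /vlineP[a ->] ->]].
  rewrite brDr scalerDr opprD addrACA brZr scalerA mulrC -scalerA -scalerBr.
  apply: rpredD; first exact: IHk. by apply: rpredZ; apply: HU.
have [cs cs0] := annihilating_roots (ad z).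
have [|||x [c [xYm xU _ xc]]] := eigenvector_mod cs0 UY.
- rewrite eq_sym; apply: contraTneq m_gt0 => e.
  by rewrite -eqn0Ngt -(eqn_add2l (\dim U)) -dY // e addn0.
- by move=> u uU; rewrite adE pU.
- by move=> w wY; rewrite adE zYm.
have YW : (Y m <= W)%VS.
  rewrite subv_add UW /=; apply/span_subvP => _ /mapP[k _ ->].
  by elim: k => //= k IHk; apply: pW.
(* The choice of scalars must be total, so 0 is taken outside p. *)
have Hx y : exists l : C, y \in p -> br y x - l *: x \in U.
  have [yp|yp] := boolP (y \in p); last by exists 0.
  move: yp; rewrite defp => /memv_addP[u uH [_ /vlineP[a ->] ->]].
  exists (lam u + a * c) => _.
  rewrite brDl scalerDl opprD addrACA brZl -scalerA -scalerBr.
  by rewrite rpredD ?(HUY m) // rpredZ // -adE.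
by have [l Hl] := choice Hx; exists x, l; rewrite (subvP YW).
Qed.

(** On a one-dimensional quotient, p acts by scalars, so a bracket acts as 0. A maximal stable U
    with zero traces must therefore be g, since Lie's theorem would enlarge it by a line. *)
Lemma solvable_kappa0 p x y z : subalgebra br p -> solvable br p ->
  x \in p -> y \in p -> z \in p -> kappa x (br y z) = 0.
Proof.
move=> sp solp.
pose P U := stable p U /\ forall x y z, x \in p -> y \in p -> z \in p ->
  trv U (ad x \o ad (br y z))%VF = 0.
have [|U [sU trU] maxU] := @ex_max_dim _ _ P 0%VS.
  split=> [y' u _|*]; last exact: trv0.
  by rewrite memv0 => /eqP ->; rewrite br0r mem0v.
have [Uf|nUf] := eqVneq U fullv.
  by move=> xp yp zp; have := trU _ _ _ xp yp zp; rewrite Uf trv_full.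
have [|w [lam [_ wU wlam]]] := lie_theorem sp solp (subvf U) nUf sU.
  by move=> *; apply: memvf.
have brw y' u : y' \in p -> u - lam y' *: w \in U -> u \in (U + <[w]>)%VS.
  by move=> y'p H; rewrite -[u](subrK (lam y' *: w)) memv_add ?rpredZ ?memv_line.
suff /maxU : P (U + <[w]>)%VS by rewrite dimv_add_line // ltnn.
split=> [y' _ y'p /memv_addP[u uU [_ /vlineP[a ->] ->]]|x' y' z' x'p y'p z'p].
  rewrite brDr brZr rpredD ?rpredZ ?(brw y' (br y' w)) ?wlam //.
  by apply: (subvP (addvSl _ _)); apply: sU.
rewrite (@trv_sub _ _ U) ?trU ?addvSl // => _ /memv_addP[u uU [_ /vlineP[a ->] ->]].
have yzp : br y' z' \in p by apply: sp.
rewrite comp_lfunE !adE sU // brDr brZr rpredD ?sU // rpredZ //.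
have E (s t : g) : s \in p -> t \in p ->
    br s (br t w) - (lam t * lam s) *: w \in U.
  move=> sp' tp; rewrite -{1}[br t w](subrK (lam t *: w)) brDr brZr -addrA.
  by rewrite -scalerA -scalerBr rpredD ?sU ?rpredZ ?wlam.
have := rpredB (E _ _ y'p z'p) (E _ _ z'p y'p).
by rewrite [lam y' * _]mulrC opprB addrA subrK brA.
Qed.

End LieAlgebra.

(** * Generalized eigenspaces *)

Section GeneralizedEigenspaces.
Variables (F : closedFieldType) (V : vectType F).
Implicit Types (f : 'End(V)) (U : {vspace V}).

Lemma lhornerXn f n v : lhorner f 'X^n v = iter n f v.
Proof.
elim: n => [|n IHn]; first by rewrite expr0 lhornerC scale1r.
by rewrite exprSr lhornerMX IHn.
Qed.

Lemma dvdp_prod_exp (cs s : seq F) : {subset cs <= s} ->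
  \prod_(c <- cs) ('X - c%:P) %| \prod_(c <- s) ('X - c%:P) ^+ size cs.
Proof.
elim: cs => [|c cs IHcs] cs_s; first by rewrite big_nil dvd1p.
rewrite big_cons /=; under [X in _ %| X]eq_bigr do rewrite exprS.
rewrite big_split dvdp_mul ?IHcs // => [|d ds].
  by rewrite (big_rem c) ?dvdp_mulIl // cs_s ?mem_head.
by rewrite cs_s // inE ds orbT.
Qed.

(** The polynomial [e c] interpolates the indicator of c. The exponent [size cs] bounds every
    multiplicity in [cs]. *)
Lemma generalized_eigen_decomposition f cs :
  lhorner f (\prod_(c <- cs) ('X - c%:P)) = 0 ->
  exists2 e : F -> {poly F}, forall v, v = \sum_(c <- undup cs) lhorner f (e c) v &
    forall c v, c \in cs ->
      lhorner f (('X - c%:P) ^+ size cs) (lhorner f (e c) v) = 0.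
Proof.
move=> f0; set N := size cs; set s := undup cs.
have us : uniq s := undup_uniq _.
have [e He] : exists e : F -> {poly F}, forall c d, d \in s ->
    ('X - d%:P) ^+ N %| e c - ((d == c)%:R)%:P.
  have H c := hermite_interp (fun d => (d == c)%:R) N us.
  by have [e He] := choice H; exists e.
have kill (r : {poly F}) v : (forall d, d \in s -> ('X - d%:P) ^+ N %| r) ->
    lhorner f r v = 0.
  move=> Hr; have := dvdp_trans (@dvdp_prod_exp cs s _) (dvdp_prod_coprime us Hr).
  move=> /(_ _)/lhorner_dvd0; apply; last by rewrite f0 zero_lfunE.
  by move=> d; rewrite mem_undup.
exists e => [v|c v ccs].
  have : lhorner f (\sum_(c <- s) e c - 1%:P) v = 0.
    apply: kill => d ds.
    have -> : \sum_(c <- s) e c - 1%:P = \sum_(c <- s) (e c - ((d == c)%:R)%:P).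
      rewrite sumrB; congr (_ - _); rewrite (big_rem d) //= eqxx.
      rewrite big_seq big1 ?addr0 // => c; rewrite mem_rem_uniq // inE eq_sym.
      by case/andP => /negPf ->.
    by elim/big_rec: _ => [|c q _ IHq]; rewrite ?dvdp0 // dvdp_add ?He.
  rewrite linearB /= add_lfunE opp_lfunE lhornerC scale1r.
  by move/eqP; rewrite subr_eq0 => /eqP E; rewrite -[LHS]E linear_sum sum_lfunE.
rewrite -lhornerM; apply: kill => d ds.
have [->|dc] := eqVneq d c; first exact: dvdp_mulIl.
rewrite dvdp_mull //; have := He c d ds.
by rewrite (negPf dc) subr0.
Qed.

(** Fitting's decomposition with a projection that is a polynomial in f, hence valid inside every
    stable U with the same N. *)
Lemma fitting f : exists N,
  (forall M v, iter M f v = 0 -> iter N f v = 0) /\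
  (forall U, (forall u, u \in U -> f u \in U) -> forall u, u \in U ->
     exists w w', [/\ u = w + iter N f w', w \in U & iter N f w = 0]).
Proof.
have [cs f0] := annihilating_roots f; set N := size cs; exists N.
(* Adding 0 forces a condition on e at 0 even if 0 is not in [cs]. *)
pose s := undup (0 :: cs); have us : uniq s := undup_uniq _.
have He M : exists e : {poly F}, 'X^M %| 1 - e /\ lhorner f ('X^N * e) = 0.
  have [e He] := hermite_interp (fun c : F => (c == 0)%:R) (maxn M N) us.
  have le_exp (r : {poly F}) n m : (n <= m)%N -> r ^+ n %| r ^+ m.
    by move=> /subnKC <-; rewrite exprD dvdp_mulIl.
  exists e; split.
    rewrite -[1 - e]opprB dvdpNr; have := He 0; rewrite mem_undup mem_head eqxx subr0.
    by move=> /(_ isT); apply/dvdp_trans/le_exp/leq_maxl.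
  apply/lfunP => v; rewrite zero_lfunE.
  apply: (@lhorner_dvd0 _ _ _ (\prod_(c <- cs) ('X - c%:P))); last first.
    by rewrite f0 zero_lfunE.
  apply: (dvdp_trans (@dvdp_prod_exp cs s _)) => [c ccs|].
    by rewrite mem_undup inE ccs orbT.
  apply: dvdp_prod_coprime => // c cs'.
  have [->|c0] := eqVneq c 0; first by rewrite subr0 dvdp_mulIl.
  rewrite dvdp_mull //; have := He c cs'; rewrite (negPf c0) subr0.
  by apply/dvdp_trans/le_exp/leq_maxr.
split=> [M v fMv|U fU u uU].
  have [e [eM eN]] := He M.
  have ev : lhorner f e v = v.
    apply/eqP; rewrite eq_sym -subr_eq0.
    have -> : v - lhorner f e v = lhorner f (1 - e) v.
      by rewrite linearB /= add_lfunE opp_lfunE lhornerC scale1r.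
    by apply/eqP/(lhorner_dvd0 eM); rewrite lhornerXn.
  by rewrite -lhornerXn -ev -lhornerM eN zero_lfunE.
have [e [/dvdpP[r er] eN]] := He N.
exists (lhorner f e u), (lhorner f r u); split.
- rewrite -lhornerXn -lhornerM mulrC -er linearB /= add_lfunE opp_lfunE.
  by rewrite lhornerC scale1r addrC subrK.
- exact: lhorner_stable.
- by rewrite -lhornerXn -lhornerM eN zero_lfunE.
Qed.

(** [ls] is the diagonal of f in a triangular form. When p(c) is the conjugate of c the trace is the
    sum of the |c|^2, and its vanishing makes f nilpotent. *)
Lemma trace_lhorner f cs p : lhorner f (\prod_(c <- cs) ('X - c%:P)) = 0 ->
  exists ls : seq F, [/\ {subset ls <= cs},
    lhorner f (\prod_(c <- ls) ('X - c%:P)) = 0 &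
    ltr (lhorner f p \o f)%VF = \sum_(c <- ls) p.[c] * c].
Proof.
move=> f0.
pose P U := (forall u, u \in U -> f u \in U) /\ exists ls : seq F,
  [/\ {subset ls <= cs},
    forall u, u \in U -> lhorner f (\prod_(c <- ls) ('X - c%:P)) u = 0 &
    trv U (lhorner f p \o f)%VF = \sum_(c <- ls) p.[c] * c].
have [|U [fU [ls [lscs fls trU]]] maxU] := @ex_max_dim _ _ P 0%VS.
  have z0 u : u \in 0%VS -> u = 0 :> V by rewrite memv0 => /eqP.
  split=> [u /z0 ->|]; first by rewrite linear0 mem0v.
  exists [::]; split=> // [u /z0 ->|]; first by rewrite linear0.
  by rewrite trv0 big_nil.
have [Uf|nUf] := eqVneq U fullv.
  exists ls; split=> //; last by rewrite -trv_full -Uf.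
  by apply/lfunP => v; rewrite fls ?zero_lfunE // Uf memvf.
have [|x [c [_ xU ccs fx]]] := eigenvector_mod f0 (subvf U) nUf fU.
  by move=> *; apply: memvf.
suff /maxU : P (U + <[x]>)%VS by rewrite dimv_add_line // ltnn.
have addx v : v - c *: x \in U -> v \in (U + <[x]>)%VS.
  by move=> H; rewrite -[v](subrK (c *: x)) memv_add ?rpredZ ?memv_line.
split=> [_ /memv_addP[u uU [_ /vlineP[a ->] ->]]|].
  rewrite linearD linearZ /= rpredD ?rpredZ ?(addx (f x)) //.
  by apply: (subvP (addvSl _ _)); apply: fU.
exists (c :: ls); split=> [d|_ /memv_addP[u uU [_ /vlineP[a ->] ->]]|].
- by rewrite inE => /orP[/eqP ->//|/lscs].
- rewrite big_cons mulrC lhornerM lhornerXsubC fls //.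
  rewrite [f _]linearD /= [f (a *: x)]linearZ /= scalerDr opprD addrACA.
  rewrite scalerA mulrC -scalerA -scalerBr.
  by rewrite rpredD ?rpredB ?rpredZ ?fU.
rewrite big_cons (@trv_quot _ _ U _ _ (p.[c] * c)) ?addvSl //.
  by rewrite dimv_add_line // subSnn mulr1 trU addrC.
move=> _ /memv_addP[u uU [_ /vlineP[a ->] ->]].
rewrite [X in X - _]linearD [X in _ + X - _]linearZ /= scalerDr opprD addrACA.
rewrite !comp_lfunE.
apply: rpredD; first by rewrite rpredB ?rpredZ ?lhorner_stable ?fU.
rewrite scalerA mulrC -scalerA -scalerBr rpredZ //.
have -> : lhorner f p (f x) - (p.[c] * c) *: x =
    lhorner f p (f x - c *: x) + c *: (lhorner f p x - p.[c] *: x).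
  rewrite [lhorner f p (_ - _)]linearB /= [lhorner f p (c *: x)]linearZ /= scalerBr.
  by rewrite scalerA [c * _]mulrC addrA subrK.
by rewrite rpredD ?rpredZ ?lhorner_stable ?lhorner_eigenmod.
Qed.

End GeneralizedEigenspaces.

(** * Cartan's criterion *)

Section CartanCriterion.
Variables (R : realType) (g : vectType R[i]) (br : g -> g -> g).
Hypothesis lieP : lie_bracket br.
Implicit Types (x y z u v w : g) (U W p : {vspace g}).
Local Notation C := R[i].
Local Notation ad := (ad br).
Local Notation kappa := (kappa br).

(** Induction on m + n through (ad x - a - b)[y, z] = [(ad x - a) y, z] + [y, (ad x - b) z]. *)
Lemma generalized_eigen_br x a b m n y z :
  lhorner (ad x) (('X - a%:P) ^+ m) y = 0 ->
  lhorner (ad x) (('X - b%:P) ^+ n) z = 0 ->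
  lhorner (ad x) (('X - (a + b)%:P) ^+ (m + n)) (br y z) = 0.
Proof.
have [k] := ubnP (m + n); elim: k => // k IHk in m n y z *; rewrite ltnS => le_k.
case: m le_k => [_|m le_k].
  by rewrite lhornerC scale1r => -> _; rewrite (br0l lieP) linear0.
case: n le_k => [_ _|n le_k].
  by rewrite lhornerC scale1r => ->; rewrite (br0r lieP) linear0.
rewrite addSn !exprSr !lhornerM !lhornerXsubC => y0 z0.
rewrite !(adE lieP) (br_jacobi lieP).
have -> : br (br x y) z + br y (br x z) - (a + b) *: br y z =
    br (ad x y - a *: y) z + br y (ad x z - b *: z).
  rewrite !(adE lieP) (brBl lieP) (brBr lieP) (brZl lieP) (brZr lieP).
  by rewrite scalerDl opprD addrACA.
have zz : lhorner (ad x) (('X - b%:P) ^+ n.+1) z = 0.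
  by rewrite exprSr lhornerM lhornerXsubC.
have yy : lhorner (ad x) (('X - a%:P) ^+ m.+1) y = 0.
  by rewrite exprSr lhornerM lhornerXsubC.
have le1 : (m + n.+1 < k)%N by [].
have le2 : (m.+1 + n < k)%N by rewrite addSnnS.
by rewrite linearD /= (IHk _ _ _ _ le1 y0 zz) add0r addnS -addSn (IHk _ _ _ _ le2 yy z0).
Qed.

(* For [phi = id] the polynomial [p] computes the semisimple part of [ad x];
   for [phi] the complex conjugation it computes its conjugate. *)
Lemma semisimple_part x (phi : C -> C) :
    {morph phi : a b / a + b} -> phi 0 = 0 ->
  exists (p : {poly C}) (cs : seq C),
    [/\ 'X %| p, lhorner (ad x) (\prod_(c <- cs) ('X - c%:P)) = 0,
        forall c, c \in cs -> p.[c] = phi c,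
        forall y z, lhorner (ad x) p (br y z) =
          br (lhorner (ad x) p y) z + br y (lhorner (ad x) p z) &
        exists2 e : C -> {poly C},
          forall v, v = \sum_(c <- undup cs) lhorner (ad x) (e c) v &
          forall c v, c \in cs -> lhorner (ad x) p (lhorner (ad x) (e c) v) =
            phi c *: lhorner (ad x) (e c) v].
Proof.
move=> phiD phi0; have [cs cs0] := annihilating_roots (ad x).
(* The sums a + b and the order N + N are what [generalized_eigen_br] requires for p(ad x) to be a
   derivation. The node 0 and the extra order give X | p even when N = 0. *)
set N := size cs; pose s := undup (0 :: cs ++ [seq a + b | a <- cs, b <- cs]).
have us : uniq s := undup_uniq _.
have [p Hp] := hermite_interp phi (N + N).+1 us.
have s0 : 0 \in s by rewrite mem_undup mem_head.
have scs c : c \in cs -> c \in s by rewrite mem_undup inE mem_cat => ->; rewrite orbT.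
have sD a b : a \in cs -> b \in cs -> a + b \in s.
  by move=> ac bc; rewrite mem_undup inE mem_cat allpairs_f ?orbT.
have act c n v : c \in s -> (n <= N + N)%N ->
    lhorner (ad x) (('X - c%:P) ^+ n) v = 0 -> lhorner (ad x) p v = phi c *: v.
  move=> cs' le_n v0; apply/eqP; rewrite -subr_eq0 -(lhornerC (ad x)).
  rewrite -opp_lfunE -add_lfunE -linearB /=; apply/eqP/(lhorner_dvd0 _ v0).
  apply: (dvdp_trans _ (Hp c cs')).
  by rewrite -(subnKC (leqW le_n)) exprD dvdp_mulIl.
have [e ev He] := generalized_eigen_decomposition cs0.
have act' c v : c \in cs -> lhorner (ad x) p (lhorner (ad x) (e c) v) =
    phi c *: lhorner (ad x) (e c) v.
  by move=> cs'; apply: (act c N); rewrite ?scs ?leq_addr ?He.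
exists p, cs; split=> //; last by exists e.
- have := Hp 0 s0; rewrite phi0 !subr0; apply: dvdp_trans.
  by rewrite exprS dvdp_mulIl.
- move=> c /scs/Hp; rewrite exprS => H.
  have := dvdp_trans (dvdp_mulIl _ _) H.
  by rewrite -root_factor_theorem rootE !hornerE subr_eq0 => /eqP.
move=> y z.
have D0 (s1 : seq C) (F : C -> g) y' :
    br (\sum_(c <- s1) F c) y' = \sum_(c <- s1) br (F c) y'.
  by rewrite -(adE lieP) linear_sum sum_lfunE; apply: eq_bigr => i _; rewrite /= adE.
have D1 (s1 : seq C) (F : C -> g) y' :
    br y' (\sum_(c <- s1) F c) = \sum_(c <- s1) br y' (F c).
  by rewrite -(adE lieP) linear_sum; apply: eq_bigr => i _; rewrite /= adE.
rewrite (ev y) (ev z) !linear_sum /= !D0 linear_sum /= -big_split.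
rewrite big_seq [RHS]big_seq; apply: eq_bigr => a /=; rewrite mem_undup => ac.
rewrite !D1 linear_sum /= -big_split.
rewrite big_seq [RHS]big_seq; apply: eq_bigr => b /=; rewrite mem_undup => bc.
rewrite (act (a + b) (N + N)%N) ?sD //; last first.
  by apply: generalized_eigen_br; apply: He.
by rewrite !act' // phiD (brZl lieP) (brZr lieP) scalerDl.
Qed.

(** Let D be the conjugate of the semisimple part of ad x. As a derivation it satisfies tr(D ad
    [y, z]) = kappa(D y, z), and X | P puts D y in [p, p], so this is 0. At x itself the trace is
    the sum of the |c|^2 over the diagonal of ad x. *)
Lemma cartan_nilpotent p x : subalgebra br p ->
    (forall y z, y \in p -> z \in derived br p -> kappa y z = 0) ->
    x \in derived br p ->
  exists k, forall v, iter k (br x) v = 0.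
Proof.
move=> sp kp xp.
have [P [cs [XP cs0 Pcs derP _]]] := semisimple_part x (rmorphD Num.conj) (rmorph0 Num.conj).
set D := lhorner (ad x) P in derP.
have adD y : ad (D y) = ((D \o ad y) - (ad y \o D))%VF.
  apply/lfunP => z; rewrite add_lfunE opp_lfunE !comp_lfunE !(adE lieP) derP.
  by rewrite addrK.
have Dp y : y \in p -> D y \in derived br p.
  move=> yp; have /dvdpP[r Er] := XP; rewrite /D Er lhornerMX (adE lieP).
  apply: mem_brspace => //; first exact: (subvP (derived_subv sp)).
  apply: lhorner_stable => // u up; rewrite (adE lieP); apply: (sp) => //.
  exact: (subvP (derived_subv sp)).
have tr0 u : u \in derived br p -> ltr (D \o ad u)%VF = 0.
  have lin : scalar (fun u => ltr (D \o ad u)%VF).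
    by move=> a v w; rewrite linearP /= comp_lfunDr -comp_lfunZr linearP.
  apply: (span_scalar0 lin) => _ /allpairsP[[y z] /= [/vbasis_mem yp /vbasis_mem zp ->]].
  have := kp z (D y) zp (Dp y yp); rewrite kappaC.
  rewrite (_ : kappa (D y) z = ltr (ad (D y) \o ad z)%VF) // adD (ad_br lieP).
  rewrite comp_lfunDl comp_lfunDr comp_lfunNl comp_lfunNr !linearB /=.
  by rewrite -!comp_lfunA => <-; congr (_ - _); rewrite [X in ltr X = _]comp_lfunA [LHS]ltr_comp.
have [ls [lscs ls0]] := trace_lhorner P cs0.
rewrite -/D tr0 // => /esym/eqP; rewrite big_seq psumr_eq0; last first.
  by move=> c /lscs ccs; rewrite Pcs // mulrC mul_conjC_ge0.
move=> /allP all0; exists (size ls) => v.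
have l0 c : c \in ls -> c = 0.
  move=> cl; have := all0 c cl; rewrite cl Pcs ?lscs //= mulrC mul_conjC_eq0.
  by move/eqP.
have := congr1 (fun f : 'End(g) => f v) ls0; rewrite zero_lfunE /= => <-.
rewrite big_seq (eq_bigr (fun=> 'X)) -?big_seq; last first.
  by move=> c /l0 ->; rewrite subr0.
rewrite big_const_seq count_predT -Monoid.iteropE -/('X ^+ size ls) lhornerXn.
by apply: eq_iter => w; rewrite adE.
Qed.

Lemma solvable0 : solvable br 0.
Proof. by exists 0%N. Qed.

Lemma nilpotent_eigen0 y U x l k : (forall u, u \in U -> br y u \in U) ->
  x \notin U -> br y x - l *: x \in U -> iter k (br y) x \in U -> l = 0.
Proof.
move=> yU xU Hx Hk; apply: contraNeq xU => l0.
have Hj j : iter j (br y) x - l ^+ j *: x \in U.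
  elim: j => [|j IHj]; first by rewrite scale1r subrr mem0v.
  have -> : iter j.+1 (br y) x - l ^+ j.+1 *: x =
     br y (iter j (br y) x - l ^+ j *: x) + l ^+ j *: (br y x - l *: x).
    by rewrite (brBr lieP) (brZr lieP) scalerBr addrA subrK scalerA -exprSr.
  by rewrite rpredD ?yU // rpredZ // Hx.
have := rpredB Hk (Hj k); rewrite opprB addrC subrK => H.
by rewrite -[x](scalerK (expf_neq0 k l0)); apply: rpredZ.
Qed.

(** By induction proper subalgebras are solvable, so suppose [p, p] = p. For a maximal proper
    subalgebra m, Lie's theorem on p/m gives an x with [m, x] in m, the eigenvalues being 0 by
    [cartan_nilpotent]. Then p = m + Cx and [p, p] <= m, a contradiction. *)
Lemma cartan_solvable p : subalgebra br p ->
  (forall y z, y \in p -> z \in derived br p -> kappa y z = 0) -> solvable br p.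
Proof.
have [n] := ubnP (\dim p); elim: n p => // n IHn p; rewrite ltnS => dp sp kp.
have IH q : subalgebra br q -> (q <= p)%VS -> q != p -> solvable br q.
  move=> sq qp nqp; apply: IHn => // [|y z yq zq]; last first.
    apply: kp; first exact: (subvP qp).
    exact: (subvP (brspaceS lieP qp qp)).
  by rewrite (leq_trans _ dp) // ltn_neqAle dimvS // (dimv_leqif_eq qp) nqp.
have [dpp|ndp] := eqVneq (derived br p) p; last first.
  apply: solvable_derived; apply: IH => //; last exact: derived_subv.
  by apply: (subalgebra_between lieP sp); rewrite ?derived_subv.
have [->|p_neq0] := eqVneq p 0%VS; first exact: solvable0.
pose P m := [/\ subalgebra br m, (m <= p)%VS & m != p].
have [|m [sm mp nmp] maxm] := @ex_max_dim _ _ P 0%VS.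
  split; rewrite ?sub0v // 1?eq_sym // => x y.
  by rewrite !memv0 => /eqP -> _; rewrite (br0l lieP).
have stm W : (W <= p)%VS -> subalgebra br W -> (m <= W)%VS -> stable br m W.
  by move=> Wp sW mW y u ym uW; apply: sW => //; apply: (subvP mW).
have [x [lam [xp xm Hx]]] := lie_theorem lieP sm (IH m sm mp nmp) mp nmp
  (stm m mp sm (subvv m)) (stm p (subvv p) sp mp).
have lam0 y : y \in m -> br y x \in m.
  move=> ym; have [|k Hk] := @cartan_nilpotent p y sp kp.
    by rewrite dpp (subvP mp).
  have := Hx y ym; rewrite (@nilpotent_eigen0 y m x (lam y) k) ?Hk ?mem0v ?Hx //.
    by rewrite scale0r subr0.
  by move=> u; apply: sm.
have sm' : subalgebra br (m + <[x]>).
  move=> _ _ /memv_addP[u um [_ /vlineP[a ->] ->]] /memv_addP[v vm [_ /vlineP[b ->] ->]].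
  apply: (subvP (addvSl _ _)).
  rewrite (brDl lieP) !(brDr lieP) !(brZl lieP) !(brZr lieP) (brxx lieP) !scaler0 addr0.
  by rewrite [br x v](brC lieP) rpredD ?rpredD ?sm ?rpredZ ?rpredN ?lam0.
have defp : (m + <[x]>)%VS = p.
  apply/eqP; apply: contraT => np; have /maxm : P (m + <[x]>)%VS.
    by split=> //; rewrite subv_add mp -memvE.
  by rewrite dimv_add_line // ltnn.
have : (derived br p <= m)%VS.
  apply: brspace_subv => s t; rewrite -defp => /memv_addP[u um [_ /vlineP[a ->] ->]].
  case/memv_addP => v vm [_ /vlineP[b ->] ->].
  rewrite (brDl lieP) !(brDr lieP) !(brZl lieP) !(brZr lieP) (brxx lieP) !scaler0 addr0.
  by rewrite [br x v](brC lieP) rpredD ?rpredD ?sm ?rpredZ ?rpredN ?lam0.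
by rewrite dpp => pm; case/negP: nmp; rewrite eqEsubv mp.
Qed.

(** * Orthogonals for the Killing form *)

Definition perp U : {vspace g} :=
  (\bigcap_(u <- vbasis U) lker (linfun (kappa u : g -> C^o)))%VS.

Lemma perpP U x : reflect (forall u, u \in U -> kappa u x = 0) (x \in perp U).
Proof.
have linE u : linfun (kappa u : g -> C^o) x = kappa u x.
  exact/linfun_linearE/kappa_linear_r.
apply: (iffP idP) => [xU u uU|H].
  rewrite (coord_vbasis uU) kappaC linear_sum big1 // => i _.
  rewrite linearZ /= kappaC.
  have Hi : (vbasis U)`_i \in vbasis U by rewrite mem_nth // size_tuple.
  move: xU; rewrite /perp (big_rem _ Hi) /= => /memv_capP[+ _].
  by rewrite memv_ker linE => /eqP ->; rewrite mulr0.
rewrite /perp big_seq; elim/big_rec: _ => [|u B uU xB]; first exact: memvf.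
by rewrite memv_cap memv_ker linE (H _ (vbasis_mem uU)) eqxx.
Qed.

Hypothesis ssP : semisimple br.

Lemma kappa_nondeg x : (forall y, kappa y x = 0) -> x = 0.
Proof.
move=> kx; suff p0 : perp fullv = 0%VS.
  by apply/eqP; rewrite -memv0 -p0; apply/perpP => u _; apply: kx.
apply: ssP => [y z /perpP kz|].
  by apply/perpP => u _; rewrite -(kappa_br lieP) kz ?memvf.
apply: cartan_solvable => [y z _ /perpP kz|y z _ zp].
  by apply/perpP => u _; rewrite -(kappa_br lieP) kz ?memvf.
move: z zp; apply: (span_scalar0 (kappa_linear_r lieP y)) => w.
move=> /allpairsP[[u v] /= [_ /vbasis_mem/perpP kv ->]].
by rewrite -(kappa_br lieP) kv ?memvf.
Qed.

(* If not, Lie's theorem gives x in b^perp \ b normalizing b, and b + Cx is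
   solvable by Cartan's criterion. *)
Lemma borel_perp b : borel br b -> (perp b <= b)%VS.
Proof.
case=> sb solb maxb; apply/idPn => nsub.
have stb : stable br b b by move=> y u; apply: sb.
have stp : stable br b (perp b).
  move=> y x yb /perpP kx; apply/perpP => u ub.
  by rewrite -(kappa_br lieP) kx // sb.
have [|x [lam [xW xb Hx]]] :=
  lie_theorem lieP sb solb (addvSr (perp b) b) _ stb (stable_add lieP stp stb).
  by apply: contra nsub => /eqP e; rewrite [X in (_ <= X)%VS]e addvSl.
case/memv_addP: xW => x0 /perpP x0p [b0 b0b ex].
have x0b : x0 \notin b by apply: contra xb => x0b; rewrite ex rpredD.
have {ex} Hx0 y : y \in b -> br y x0 \in (b + <[x0]>)%VS.
  move=> yb; have := Hx y yb; rewrite ex (brDr lieP) scalerDr => H.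
  have -> : br y x0 = (br y x0 + br y b0 - (lam y *: x0 + lam y *: b0))
      + (lam y *: b0 - br y b0) + lam y *: x0.
    by rewrite opprD [br y x0 + _ + _]addrACA -[_ - br y b0]opprB addrK subrK.
  apply: memv_add; last by rewrite rpredZ ?memv_line.
  by apply: rpredD H _; rewrite rpredB ?rpredZ ?sb.
have inb u : u \in b -> u \in (b + <[x0]>)%VS by apply: (subvP (addvSl _ _)).
have sx : subalgebra br (b + <[x0]>).
  move=> _ _ /memv_addP[u ub [_ /vlineP[a ->] ->]] /memv_addP[v vb [_ /vlineP[c ->] ->]].
  rewrite (brDl lieP) !(brDr lieP) !(brZl lieP) !(brZr lieP) (brxx lieP) !scaler0 addr0.
  rewrite [br x0 v](brC lieP) rpredD ?rpredZ ?rpredN ?Hx0 //.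
  by rewrite rpredD ?rpredZ ?Hx0 // inb ?sb.
have solx : solvable br (b + <[x0]>).
  apply: cartan_solvable => // y z yp zp.
  move: z zp; apply: (span_scalar0 (kappa_linear_r lieP y)) => w.
  move=> /allpairsP[[u v] /= [/vbasis_mem up /vbasis_mem vp ->]].
  case/memv_addP: yp => y1 y1b [_ /vlineP[a ->] ->].
  case/memv_addP: up => u1 u1b [_ /vlineP[c ->] ->].
  case/memv_addP: vp => v1 v1b [_ /vlineP[d ->] ->].
  have k0 s t : s \in b -> t \in b -> kappa x0 (br s t) = 0.
    by move=> sb' tb; rewrite kappaC x0p ?sb.
  have kxx s : kappa x0 (br s x0) = 0.
    by rewrite kappaC (kappa_br lieP) (brxx lieP) linear0.
  have kbx s t : s \in b -> t \in b -> kappa s (br t x0) = 0.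
    by move=> sb' tb; rewrite -(kappa_br lieP) x0p ?sb.
  rewrite (brDl lieP) !(brDr lieP) !(brZl lieP) !(brZr lieP) (brxx lieP) !scaler0 addr0.
  rewrite [br x0 v1](brC lieP) (kappaDl lieP) (kappaZl lieP).
  rewrite !(kappaDr lieP) !(kappaZr lieP) !(kappaNr lieP).
  rewrite (solvable_kappa0 lieP sb solb) // k0 // !(kbx y1) // !kxx.
  by rewrite !(oppr0, mulr0, addr0).
by case/negP: x0b; rewrite -(maxb _ sx solx (addvSl _ _)) (subvP (addvSr _ _)) ?memv_line.
Qed.

End CartanCriterion.

(** * Cartan subalgebras *)

Section CartanSubalgebra.
Variables (R : realType) (g : vectType R[i]) (br : g -> g -> g).
Hypothesis lieP : lie_bracket br.
Hypothesis ssP : semisimple br.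
Implicit Types (x y z u v w : g) (U W p : {vspace g}).
Local Notation C := R[i].
Local Notation ad := (ad br).
Local Notation kappa := (kappa br).

Lemma iter_ad x n v : iter n (ad x) v = iter n (br x) v.
Proof. by apply: eq_iter => w; rewrite adE. Qed.

(** Coordinates turn d -> kappa(d, -) into an endomorphism of U, injective by nondegeneracy and so
    onto. It serves both U = g and U = h. *)
Lemma kappa_represents U (phi : g -> C) : scalar phi ->
  (forall x, x \in U -> (forall y, y \in U -> kappa y x = 0) -> x = 0) ->
  exists2 d, d \in U & forall y, y \in U -> kappa d y = phi y.
Proof.
move=> linphi ndU; pose X := vbasis U.
have XU (i : 'I_(\dim U)) : X`_i \in U.
  by apply/vbasis_mem/mem_nth; rewrite size_tuple.
pose Phi := linfun (fun d => \sum_(i < \dim U) kappa d X`_i *: X`_i).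
have PhiE d : Phi d = \sum_(i < \dim U) kappa d X`_i *: X`_i.
  apply: (linfun_linearE (f := fun d => \sum_(i < \dim U) kappa d X`_i *: X`_i)).
  move=> a x y; rewrite scaler_sumr -big_split; apply: eq_bigr => i _ /=.
  by rewrite (kappaDl lieP) (kappaZl lieP) scalerDl scalerA.
have freeX : free X := basis_free (vbasisP U).
have PhiU : (Phi @: U <= U)%VS.
  apply/subvP => _ /memv_imgP[d _ ->]; rewrite PhiE rpred_sum // => i _.
  by rewrite rpredZ.
have kerPhi : (U :&: lker Phi = 0)%VS.
  apply/eqP; rewrite -subv0; apply/subvP => d /memv_capP[dU].
  rewrite memv_ker PhiE memv0 => /eqP d0; apply/eqP/ndU => // y yU.
  have /freeP/(_ (fun i : 'I_(\dim U) => kappa d X`_i) d0) k0 := freeX.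
  rewrite kappaC (coord_vbasis yU).
  have E (s : seq 'I_(\dim U)) (c : 'I_(\dim U) -> C) :
      kappa d (\sum_(i <- s) c i *: X`_i) = 0.
    elim/big_rec: _ => [|i v _ IHv]; first by rewrite (kappa0r lieP).
    by rewrite (kappaDr lieP) (kappaZr lieP) k0 mulr0 add0r.
  exact: E.
have dimPhi := limg_dim_eq kerPhi.
have PhiUU : (Phi @: U)%VS = U.
  by apply/eqP; rewrite eqEdim PhiU dimPhi leqnn.
have : \sum_(i < \dim U) phi X`_i *: X`_i \in (Phi @: U)%VS.
  by rewrite PhiUU rpred_sum // => i _; rewrite rpredZ.
case/memv_imgP => d dU; rewrite PhiE => Ed; exists d => // y yU.
have Ei (i : 'I_(\dim U)) : phi X`_i = kappa d X`_i.
  rewrite -(coord_sum_free (fun i : 'I_(\dim U) => phi X`_i) i freeX) Ed.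
  exact: coord_sum_free.
have lin0 (s : seq 'I_(\dim U)) (c : 'I_(\dim U) -> C) :
    kappa d (\sum_(i <- s) c i *: X`_i) = phi (\sum_(i <- s) c i *: X`_i).
  have phi0 : phi 0 = 0.
    by have := linphi (- 1) 0 0; rewrite scaler0 addr0 mulN1r addNr.
  elim: s => [|i s IHs]; first by rewrite !big_nil phi0 (kappa0r lieP).
  by rewrite !big_cons (kappaDr lieP) (kappaZr lieP) linphi Ei IHs.
by rewrite (coord_vbasis yU); apply: lin0.
Qed.

(** The element d represents y -> tr(D ad y); since tr(D ad [y, z]) = kappa(D y, z), the difference
    D y - [d, y] is orthogonal to g. *)
Lemma derivation_inner (D : 'End(g)) :
  (forall y z, D (br y z) = br (D y) z + br y (D z)) ->
  exists d, forall y, D y = br d y.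
Proof.
move=> derD.
have [||d _ Hd] := @kappa_represents fullv (fun y => ltr (D \o ad y)%VF).
- by move=> a x y; rewrite (ad_is_linear lieP) comp_lfunDr -comp_lfunZr linearP.
- by move=> x _ H; apply: (kappa_nondeg lieP ssP) => y; apply: H; apply: memvf.
exists d => y; apply/eqP; rewrite -subr_eq0; apply/eqP.
apply: (kappa_nondeg lieP ssP) => z; rewrite kappaC.
have adD u : ad (D u) = ((D \o ad u) - (ad u \o D))%VF.
  apply/lfunP => v; rewrite add_lfunE opp_lfunE !comp_lfunE !(adE lieP) derD.
  by rewrite addrK.
rewrite (kappaDl lieP) (kappaNl lieP) (kappa_br lieP) Hd ?memvf //.
rewrite (_ : kappa (D y) z = ltr (ad (D y) \o ad z)%VF) // adD (ad_br lieP).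
apply/eqP; rewrite subr_eq0; apply/eqP.
rewrite !(comp_lfunDl, comp_lfunDr, comp_lfunNl, comp_lfunNr) !linearB /= -!comp_lfunA.
congr (_ - _).
by rewrite [LHS]ltr_comp -comp_lfunA.
Qed.

Lemma kappa_iter x k v w :
  kappa (iter k (br x) w) v = (- 1) ^+ k * kappa w (iter k (br x) v).
Proof.
elim: k v => [|k IHk] v; first by rewrite mul1r.
rewrite iterS [br x _](brC lieP) (kappaNl lieP) (kappa_br lieP) IHk -iterSr.
by rewrite exprS mulN1r mulNr.
Qed.

Variable h : {vspace g}.
Hypothesis subh : subalgebra br h.
Hypothesis solvh : solvable br h.
Hypothesis nilh : exists n, forall x y, x \in h -> y \in h -> iter n (br x) y = 0.
Hypothesis normh : forall x, (forall y, y \in h -> br x y \in h) -> x \in h.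

(** Take V minimal among the h-stable subspaces containing h on which the form is nondegenerate. For
    y in h the Fitting null part of V is again such a subspace, so ad y is nilpotent on V. If V were
    larger than h, Lie's theorem would give a vector of V outside h that normalizes h. *)
Lemma cartan_kappa_nondeg x : x \in h ->
  (forall y, y \in h -> kappa y x = 0) -> x = 0.
Proof.
pose P V := [/\ (h <= V)%VS, stable br h V & forall v, v \in V ->
  (forall w, w \in V -> kappa w v = 0) -> v = 0].
have [|V [hV sV ndV] minV] := @ex_min_dim _ _ P fullv.
  split=> [|y u _ _|v _ Hv]; [exact: subvf|exact: memvf|].
  by apply: (kappa_nondeg lieP ssP) => y; apply: Hv; apply: memvf.
suff -> : h = V by apply: ndV.
have nilV y : y \in h -> exists N, forall v, v \in V -> iter N (br y) v = 0.
  move=> yh; have [N [fitA fitB]] := fitting (ad y); exists N.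
  have {}fitA M v : iter M (br y) v = 0 -> iter N (br y) v = 0.
    by rewrite -!iter_ad; apply: fitA.
  pose V0 := (V :&: lker (lpow (ad y) N))%VS.
  have V0P v : (v \in V0) = (v \in V) && (iter N (br y) v == 0).
    by rewrite memv_cap memv_ker lpowE iter_ad.
  suff /minV : P V0.
    move=> dV v vV; have := vV.
    have /eqP <- : V0 == V by rewrite eqEdim capvSl.
    by rewrite V0P => /andP[_ /eqP].
  have [n Hn] := nilh.
  split.
  - apply/subvP => z zh; rewrite V0P (subvP hV) //=.
    by apply/eqP/(fitA n)/Hn.
  - move=> z v zh; rewrite !V0P => /andP[vV /eqP v0].
    rewrite sV //=; apply/eqP/(fitA (n + N)%N).
    have := @generalized_eigen_br _ _ _ lieP y 0 0 n N z v.
    by rewrite addr0 !subr0 !lhornerXn !iter_ad => -> //; apply: Hn.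
  - move=> v; rewrite V0P => /andP[vV /eqP v0] Hv; apply: ndV => // u uV.
    (* The image of (ad y)^N is orthogonal to the null part by invariance, so only the null
       component of u matters. *)
    have [|w [w' [-> wV w0]]] := fitB V _ u uV.
      by move=> s sV'; rewrite (adE lieP); apply: sV.
    rewrite (kappaDl lieP) iter_ad kappa_iter v0 (kappa0r lieP) mulr0 addr0.
    by apply: Hv; rewrite V0P wV -iter_ad w0 eqxx.
apply/eqP; apply/idPn => nhV.
have sh : stable br h h by move=> y u; apply: subh.
have [x0 [lam [xV xh Hx]]] := lie_theorem lieP subh solvh hV nhV sh sV.
case/negP: (xh); apply: normh => y yh; rewrite (brC lieP) rpredN.
have [N HN] := nilV y yh.
have l0 : lam y = 0.
  apply: (@nilpotent_eigen0 _ _ _ lieP y h x0 (lam y) N) => [u|||].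
  - exact: subh.
  - exact: xh.
  - exact: Hx.
  - by rewrite HN ?mem0v.
by have := Hx y yh; rewrite l0 scale0r subr0.
Qed.

(** [x, y] is orthogonal to h by [solvable_kappa0]. *)
Lemma cartan_abelian x y : x \in h -> y \in h -> br x y = 0.
Proof.
move=> xh yh; apply: cartan_kappa_nondeg; first exact: subh.
by move=> z zh; apply: (solvable_kappa0 lieP subh solvh).
Qed.

Lemma cartan_centralizer x : (forall y, y \in h -> br y x = 0) -> x \in h.
Proof.
by move=> Hx; apply: normh => y yh; rewrite (brC lieP) Hx // oppr0 mem0v.
Qed.

(** The semisimple part of ad x is an inner derivation ad d. It is a polynomial in ad x without
    constant term, so d centralizes h and lies in it. Then ad (x - d) is nilpotent and commutes with
    ad h, so x - d is orthogonal to h and vanishes. *)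
Lemma cartan_semisimple x : x \in h -> exists (cs : seq C) (e : C -> {poly C}),
  (forall v, v = \sum_(c <- cs) lhorner (ad x) (e c) v) /\
  (forall c v, c \in cs ->
    br x (lhorner (ad x) (e c) v) = c *: lhorner (ad x) (e c) v).
Proof.
move=> xh; have [//|//|p [cs [Xp cs0 pcs derp [e ev He]]]] :=
  @semisimple_part _ _ _ lieP x id.
set D := lhorner (ad x) p in derp.
have [d Hd] := derivation_inner derp.
have dh : d \in h.
  apply: cartan_centralizer => y yh; rewrite (brC lieP) -Hd.
  have /dvdpP[r Er] := Xp; rewrite /D Er lhornerM lhornerX (adE lieP).
  by rewrite cartan_abelian // linear0 oppr0.
have Dad v : br (x - d) v = lhorner (ad x) ('X - p) v.
  by rewrite linearB /= add_lfunE opp_lfunE lhornerX (adE lieP) Hd (brBl lieP).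
have nilxd v : iter (size cs) (br (x - d)) v = 0.
  have -> : iter (size cs) (br (x - d)) v = lhorner (ad x) (('X - p) ^+ size cs) v.
    elim: (size cs) v => [|n IHn] v; first by rewrite lhornerC scale1r.
    by rewrite exprSr lhornerM -Dad -IHn iterSr.
  apply: (@lhorner_dvd0 _ _ _ (\prod_(c <- cs) ('X - c%:P))); last first.
    by rewrite cs0 zero_lfunE.
  have : forall c, c \in cs -> 'X - c%:P %| 'X - p.
    by move=> c ccs; rewrite -root_factor_theorem rootE !hornerE pcs ?subrr.
  elim: (cs) => [|c s IHs] H; first by rewrite big_nil dvd1p.
  rewrite big_cons exprS dvdp_mul ?H ?mem_head ?IHs // => c' c's.
  by apply: H; rewrite inE c's orbT.
have xd : x - d = 0.
  apply: cartan_kappa_nondeg; first exact: rpredB.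
  move=> y yh; rewrite (_ : kappa y _ = ltr (ad y \o ad (x - d))%VF) // -trv_full.
  apply: (@trv_nilp _ _ _ _ (size cs)) => [*|u _]; first exact: memvf.
  have comm k v : ad y (iter k (br (x - d)) v) = iter k (br (x - d)) (ad y v).
    elim: k => //= k <-; rewrite !(adE lieP) (br_jacobi lieP y).
    by rewrite (cartan_abelian yh) ?rpredB // (br0l lieP) add0r.
  have -> : iter (size cs) (ad y \o ad (x - d))%VF u =
     iter (size cs) (br (x - d)) (iter (size cs) (ad y) u).
    elim: (size cs) u => // k IHk u.
    rewrite iterSr IHk comp_lfunE [ad (x - d) u](adE lieP).
    rewrite [RHS]iterSr [in RHS]iterSr; congr (iter k _ _).
    have comm' j v : br (x - d) (iter j (ad y) v) = iter j (ad y) (br (x - d) v).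
      by elim: j v => //= j IHj v; rewrite -IHj; have := comm 1%N (iter j (ad y) v).
    by rewrite comm' (comm 1%N).
  exact: nilxd.
exists (undup cs), e; split=> // c v; rewrite mem_undup => ccs.
by rewrite -He // Hd; congr br; apply/eqP; rewrite -subr_eq0 xd.
Qed.

(** Each new x splits the vectors already found by polynomials in ad x; h being abelian, these
    preserve the earlier eigenvalues. *)
Lemma joint_eigenvectors (bs : seq g) v : {subset bs <= h} ->
  exists2 ws : seq g, v = \sum_(w <- ws) w &
    forall w, w \in ws -> forall b, b \in bs -> exists c : C, br b w = c *: w.
Proof.
elim: bs v => [|x bs IHbs] v bsh; first by exists [:: v]; rewrite ?big_seq1.
have [w bw|ws -> Hws] := IHbs v; first by apply: bsh; rewrite inE bw orbT.
have [cs [e [ev He]]] := cartan_semisimple (bsh x (mem_head x bs)).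
exists [seq lhorner (ad x) (e c) w | w <- ws, c <- cs].
  rewrite big_allpairs_dep; apply: eq_bigr => w _; exact: ev.
move=> _ /allpairsP[[w c] /= [wws ccs ->]] b; rewrite inE => /orP[/eqP->|bbs].
  by exists c; apply: He.
have [d Hd] := Hws w wws b bbs; exists d.
have bh : b \in h by apply: bsh; rewrite inE bbs orbT.
rewrite -(adE lieP) lhorner_commute ?(adE lieP) ?Hd ?linearZ // => u.
rewrite !(adE lieP) (br_jacobi lieP) (cartan_abelian bh) ?(br0l lieP) ?add0r //.
by apply: bsh; rewrite mem_head.
Qed.

Implicit Types (a b : hdual h).
Local Notation rootsp := (rootsp br).

Lemma rootspP a w :
  reflect (forall y, y \in h -> br y w = (a (vsproj h y) : C) *: w) (w \in rootsp a).
Proof.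
have linE y : linfun (fun X : g => br y X - (a (vsproj h y) : C) *: X) w
    = br y w - (a (vsproj h y) : C) *: w.
  apply: (linfun_linearE (f := fun X : g => br y X - (a (vsproj h y) : C) *: X)).
  move=> c u v; rewrite (brDr lieP) (brZr lieP) [in LHS]scalerDr opprD addrACA.
  by rewrite scalerBr !scalerA mulrC.
apply: (iffP idP) => [wa y yh|H]; last first.
  rewrite /rootsp big_seq; elim/big_rec: _ => [|u B uh wB]; first exact: memvf.
  by rewrite memv_cap memv_ker linE H ?(vbasis_mem uh) // subrr eqxx.
have Hi i : br (vbasis h)`_i w = (a (vsproj h (vbasis h)`_i) : C) *: w.
  have [ih|ih] := ltnP i (\dim h); last first.
    by rewrite nth_default ?size_tuple // (br0l lieP) !linear0 scale0r.
  have hi : (vbasis h)`_i \in vbasis h by rewrite mem_nth // size_tuple.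
  move: wa; rewrite /Defs.rootsp (big_rem _ hi) /= => /memv_capP[+ _].
  by rewrite memv_ker linE subr_eq0 => /eqP.
rewrite (coord_vbasis yh) !linear_sum scaler_suml -(adE lieP).
rewrite (_ : ad _ = \sum_(i < \dim h) coord (vbasis h) i y *: ad (vbasis h)`_i).
  rewrite sum_lfunE; apply: eq_bigr => i _.
  by rewrite scale_lfunE (adE lieP) Hi scalerA linearZ linearZ.
apply/lfunP => v; rewrite (adE lieP) sum_lfunE.
elim/big_rec2: _ => [|i s t _ <-]; first by rewrite (br0l lieP).
by rewrite (brDl lieP) (brZl lieP) scale_lfunE (adE lieP).
Qed.

Lemma mem_rootsp0 w : (w \in rootsp (0 : hdual h)) = (w \in h).
Proof.
apply/rootspP/idP => [H|wh y yh].
  by apply: cartan_centralizer => y /H ->; rewrite zero_lfunE scale0r.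
by rewrite zero_lfunE scale0r cartan_abelian.
Qed.

Lemma joint_eigenvector_rootsp w : w != 0 ->
    (forall y, y \in h -> exists c : C, br y w = c *: w) ->
  exists a, w \in rootsp a.
Proof.
move=> w0 Hw.
have fw : free [tuple w] by rewrite seq1_free.
pose f (H : subvs_of h) : C^o := coord [tuple w] ord0 (br (vsval H) w).
have linf : linear f.
  by move=> c s t; rewrite /f linearP (brDl lieP) (brZl lieP) linearP.
exists (linfun f); apply/rootspP => y yh.
rewrite (linfun_linearE linf) /f vsprojK //.
have [c ->] := Hw y yh.
by rewrite linearZ /= (coord_free ord0 ord0 fw) eqxx mulr1.
Qed.

End CartanSubalgebra.

(** * Real forms *)

Section RealForm.
Variables (R : realType) (g : vectType R[i]) (br : g -> g -> g).
Hypothesis lieP : lie_bracket br.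
Variable sigma : g -> g.
Hypothesis sigmaP : antilinear_involution br sigma.
Implicit Types (x y z u v w : g) (U W p : {vspace g}).
Local Notation C := R[i].

Lemma sigmaD x y : sigma (x + y) = sigma x + sigma y.
Proof. by case: sigmaP => H _ _; have := H 1 x y; rewrite rmorph1 !scale1r. Qed.
Lemma sigma0 : sigma 0 = 0.
Proof. by apply: (addrI (sigma 0)); rewrite -sigmaD !addr0. Qed.
Lemma sigmaZ a x : sigma (a *: x) = a^* *: sigma x.
Proof. by case: sigmaP => H _ _; have := H a x 0; rewrite !addr0 sigma0 addr0. Qed.
Lemma sigmaK : involutive sigma.
Proof. by case: sigmaP. Qed.
Lemma sigma_br x y : sigma (br x y) = br (sigma x) (sigma y).
Proof. by case: sigmaP. Qed.

Lemma mem_sigma_img U x : (x \in sigma_img sigma U) = (sigma x \in U).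
Proof.
have sub (V : {vspace g}) y : y \in V -> sigma y \in sigma_img sigma V.
  move=> yV; rewrite (coord_vbasis yV).
  have E (s : seq 'I_(\dim V)) (c : 'I_(\dim V) -> C) :
      sigma (\sum_(i <- s) c i *: (vbasis V)`_i) \in sigma_img sigma V.
    elim: s => [|i s IHs]; first by rewrite big_nil sigma0 mem0v.
    rewrite big_cons sigmaD sigmaZ rpredD ?rpredZ //; apply: memv_span.
    by apply: map_f; rewrite mem_nth // size_tuple.
  exact: E.
apply/idP/idP => [xU|/sub]; last by rewrite sigmaK.
have E (s : seq 'I_(\dim U)) (c : 'I_(\dim U) -> C) :
    sigma (\sum_(i <- s) c i *: (map sigma (vbasis U))`_i) \in U.
  elim: s => [|i s IHs]; first by rewrite big_nil sigma0 mem0v.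
  rewrite big_cons sigmaD sigmaZ rpredD ?rpredZ // (nth_map 0) ?size_tuple //.
  by rewrite sigmaK vbasis_mem // mem_nth // size_tuple.
have := @coord_span _ _ _ [tuple of map sigma (vbasis U)] x xU => ->.
exact: E.
Qed.

Lemma real_imaginary_parts x : exists u v,
  [/\ sigma u = u, sigma v = v,
      (forall (U : {vspace g}), x \in U -> sigma x \in U -> u \in U /\ v \in U),
      (exists a b c d : C, u = a *: x + b *: sigma x /\ v = c *: x + d *: sigma x) &
      x = u + 'i *: v].
Proof.
have two : (2 : C) != 0 by rewrite pnatr_eq0.
(* u = (x + sigma x)/2 and v = (x - sigma x)/(2i). *)
pose a : C := 2^-1; pose c : C := - ('i * a).
have ca : a^* = a by rewrite /a fmorphV rmorph_nat.
have cc : c^* = - c by rewrite /c rmorphN rmorphM /= ca conjCi mulNr.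
have ncc : (- c)^* = c by rewrite -cc conjCK.
have ic : 'i * c = a by rewrite /c mulrN mulrA -expr2 sqrCi mulN1r opprK.
have aa : a + a = 1 by rewrite -mulr2n -mulr_natl divff.
clearbody a c.
exists (a *: x + a *: sigma x), (c *: x + (- c) *: sigma x); split.
- by rewrite sigmaD !sigmaZ sigmaK ca addrC.
- by rewrite sigmaD !sigmaZ sigmaK cc ncc addrC.
- by move=> U xU sxU; rewrite !rpredD ?rpredZ.
- by exists a, a, c, (- c).
- rewrite scalerDr !scalerA mulrN ic addrACA -!scalerDl subrr scale0r addr0.
  by rewrite aa scale1r.
Qed.

Variable h : {vspace g}.
Hypothesis sigmah : forall x, x \in h -> sigma x \in h.
Hypothesis cartanh : real_cartan_fixed br sigma h.

Lemma complexified_subset (q : {vspace g}) :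
  (forall x, x \in h -> sigma x = x -> x \in q) -> (h <= q)%VS.
Proof.
move=> hq; apply/subvP => x xh.
have [u [v [su sv Huv _ ->]]] := real_imaginary_parts x.
by have [uh vh] := Huv h xh (sigmah xh); rewrite rpredD ?rpredZ ?hq.
Qed.

Lemma complexified_subalgebra : subalgebra br h.
Proof.
have [hs _ _] := cartanh.
move=> x y xh yh.
have [u [v [su sv /(_ h xh (sigmah xh))[uh vh] _ ->]]] := real_imaginary_parts x.
have [s [t [ss st /(_ h yh (sigmah yh))[sh th] _ ->]]] := real_imaginary_parts y.
have H a b : a \in h -> sigma a = a -> b \in h -> sigma b = b -> br a b \in h.
  by move=> ah sa bh sb; have [] := hs a b (conj ah sa) (conj bh sb).
rewrite (brDl lieP) !(brDr lieP) !(brZl lieP) !(brZr lieP).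
by rewrite !rpredD ?rpredZ ?H.
Qed.

Lemma complexified_self_normalizing x :
  (forall y, y \in h -> br x y \in h) -> x \in h.
Proof.
move=> Hx; have [_ _ normh] := cartanh.
have [u [v [su sv _ [a [b [c [d [eu ev]]]]] ->]]] := real_imaginary_parts x.
have Hs y : y \in h -> sigma y = y -> br (sigma x) y \in h.
  by move=> yh sy; rewrite -sy -sigma_br sigmah // Hx.
have [uh _] : u \in h /\ sigma u = u.
  apply: normh => // y [yh sy]; split; last by rewrite sigma_br su sy.
  by rewrite eu (brDl lieP) !(brZl lieP) rpredD ?rpredZ ?Hx ?Hs.
have [vh _] : v \in h /\ sigma v = v.
  apply: normh => // y [yh sy]; split; last by rewrite sigma_br sv sy.
  by rewrite ev (brDl lieP) !(brZl lieP) rpredD ?rpredZ ?Hx ?Hs.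
by rewrite rpredD ?rpredZ.
Qed.

Let lcs k : {vspace g} := iter k (brspace br h) h.

(** The hypothesis concerns iterated brackets of fixed elements; splitting one entry at a time into
    real and imaginary parts carries it to the complex lower central series. In [S], words of length
    n - k act on the k-th term. *)
Lemma complexified_lcs : exists n, lcs n = 0%VS.
Proof.
have [_ [n Hn] _] := cartanh; exists n.
have linit xs : linear (iterbr br xs).
  elim: xs => // x xs IHxs a y z.
  rewrite -[LHS]/(br x (iterbr br xs (a *: y + z))).
  by rewrite IHxs (brDr lieP) (brZr lieP).
suff S k : forall z, z \in lcs k -> forall xs, (size xs + k)%N = n ->
    (forall x, x \in xs -> x \in h /\ sigma x = x) -> iterbr br xs z = 0.
  apply/eqP; rewrite -subv0; apply/subvP => z zn.
  by rewrite memv0 -[z]/(iterbr br [::] z) (S n).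
elim: k => [|k IHk] z /= zk xs sz xsh.
  rewrite addn0 in sz.
  have [u [v [su sv /(_ h zk (sigmah zk))[uh vh] _ ->]]] := real_imaginary_parts z.
  by rewrite addrC linit !Hn // scaler0 addr0.
suff : (brspace br h (lcs k) <= lker (linfun (iterbr br xs)))%VS.
  by move/subvP/(_ z zk); rewrite memv_ker (linfun_linearE (linit xs)) => /eqP.
apply: (brspace_subv) => u v uh vk.
rewrite memv_ker (linfun_linearE (linit xs)).
have R0 u' : u' \in h -> sigma u' = u' -> iterbr br xs (br u' v) = 0.
  move=> uh' su'; have -> : iterbr br xs (br u' v) = iterbr br (rcons xs u') v.
    by rewrite /iterbr -cats1 foldr_cat.
  apply: IHk => //; first by rewrite size_rcons addSnnS.
  by move=> x; rewrite mem_rcons inE => /orP[/eqP->|/xsh].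
have [s [t [ss st /(_ h uh (sigmah uh))[sh th] _ ->]]] := real_imaginary_parts u.
by rewrite addrC (brDl lieP) (brZl lieP) linit !R0 // scaler0 addr0.
Qed.

Lemma complexified_nilpotent :
  exists n, forall x y, x \in h -> y \in h -> iter n (br x) y = 0.
Proof.
have [n Hn] := complexified_lcs; exists n => x y xh yh.
apply/eqP; rewrite -memv0 -Hn.
by elim: (n) => //= k IHk; apply: mem_brspace.
Qed.

Lemma complexified_solvable : solvable br h.
Proof.
have [n Hn] := complexified_lcs; exists n; apply/eqP; rewrite -subv0 -Hn.
have sub k : (iter k (derived br) h <= h)%VS.
  elim: k => //= k IHk; apply: brspace_subv => u v uk vk.
  by apply: complexified_subalgebra; apply: (subvP IHk).
by elim: n {Hn} => //= k IHk; apply: (brspaceS lieP (sub k)).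
Qed.

End RealForm.

(** * Counting along an involution *)

Section Counting.
Variables (T : eqType) (s : seq T) (r : T -> T).
Hypothesis us : uniq s.
Hypothesis rs_in : forall x, x \in s -> r x \in s.
Hypothesis rK : forall x, x \in s -> r (r x) = x.

Lemma perm_involution : perm_eq (map r s) s.
Proof.
apply: uniq_perm => //.
  by rewrite map_inj_in_uniq // => x y xs ys e; rewrite -(rK xs) e rK.
move=> x; apply/mapP/idP => [[y ys ->]|xs]; first exact: rs_in.
by exists (r x); rewrite ?rs_in ?rK.
Qed.

Lemma count_involution (P : pred T) : count [pred x | P (r x)] s = count P s.
Proof. by rewrite -[RHS](permP perm_involution) count_map. Qed.

(* The rearrangement inequality on each pair {x, r x}. *)
Lemma rearrangement (A B : pred T) :
  (forall x, x \in s -> (A x -> A (r x)) /\ (B (r x) -> B x) \/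
     (A (r x) -> A x) /\ (B x -> B (r x))) ->
  ((count [pred x | A x && B x] s).*2 +
   count [pred x | [&& A x, ~~ A (r x), ~~ B x & B (r x)]] s <=
   (count [pred x | A x && B (r x)] s).*2)%N.
Proof.
move=> H; rewrite -!addnn -{2}(count_involution [pred x | A x && B x]).
rewrite -{2}(count_involution [pred x | A x && B (r x)]).
have cE P : count P s = (\sum_(x <- s) P x)%N.
  by rewrite -sum1_count big_mkcond; apply: eq_bigr => x _; case: (P x).
rewrite !cE -!big_split /= big_seq [X in (_ <= X)%N]big_seq.
apply: leq_sum => x xs; have := H x xs; rewrite rK //.
by case: (A x) (A (r x)) (B x) (B (r x)) => -[] [] [] [[H1 H2]|[H1 H2]] //;
  try (by have := H1 isT); try (by have := H2 isT).
Qed.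

End Counting.

(** * Root spaces *)

Section RootSpaces.
Variables (R : realType) (g : vectType R[i]) (br : g -> g -> g).
Hypothesis lieP : lie_bracket br.
Hypothesis ssP : semisimple br.
Variable h : {vspace g}.
Hypothesis subh : subalgebra br h.
Hypothesis solvh : solvable br h.
Hypothesis nilh : exists n, forall x y, x \in h -> y \in h -> iter n (br x) y = 0.
Hypothesis normh : forall x, (forall y, y \in h -> br x y \in h) -> x \in h.
Implicit Types (x y z u v w : g) (U W p : {vspace g}) (a b c : hdual h).
Local Notation C := R[i].
Local Notation ad := (ad br).
Local Notation kappa := (kappa br).

(* Abstract copies of the family of root spaces and of the set of roots: the
   conversion tests made by [done] between membership hypotheses and goals
   would unfold the originals, which is extremely slow. *)
Variable gsp : hdual h -> {vspace g}.
Hypothesis gspE : forall a, gsp a = rootsp br a.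
Variable root : pred (hdual h).
Hypothesis rtE : forall a, root a = (a != 0) && (gsp a != 0%VS).
Variable rs : seq (hdual h).
Hypothesis rsP : forall a, (a \in rs) = root a.

(** [vsproj] extends the weight linearly to g, so that no membership proof is carried around; it is
    the weight itself only on h. *)
Definition ev a y : C := a (vsproj h y).

Lemma evD a b y : ev (a + b) y = ev a y + ev b y.
Proof. by rewrite /ev add_lfunE. Qed.
Lemma evN a y : ev (- a) y = - ev a y.
Proof. by rewrite /ev opp_lfunE. Qed.
Lemma evB a b y : ev (a - b) y = ev a y - ev b y.
Proof. by rewrite evD evN. Qed.
Lemma evZ k a y : ev (k *: a) y = k * ev a y.
Proof. by rewrite /ev scale_lfunE. Qed.
Lemma ev0 y : ev 0 y = 0.
Proof. by rewrite /ev zero_lfunE. Qed.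
Lemma evMn a n y : ev (a *+ n) y = ev a y *+ n.
Proof. by elim: n => [|n IHn]; rewrite ?mulr0n ?ev0 // !mulrS evD IHn. Qed.
Lemma ev_linear a : scalar (ev a).
Proof. by move=> k y z; rewrite /ev !linearP. Qed.
Lemma evDr a y z : ev a (y + z) = ev a y + ev a z.
Proof. by rewrite /ev !linearD. Qed.
Lemma evNr a y : ev a (- y) = - ev a y.
Proof. by rewrite /ev !linearN. Qed.
Lemma evZr a k y : ev a (k *: y) = k * ev a y.
Proof. by rewrite /ev !linearZ. Qed.

Lemma ev_neq a b : a != b -> exists2 y, y \in h & ev a y != ev b y.
Proof.
by move=> /lfunPn[H aH]; exists (vsval H); rewrite ?subvsP // /ev vsvalK.
Qed.

Lemma ev_neq0 a : a != 0 -> exists2 y, y \in h & ev a y != 0.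
Proof. by move=> /ev_neq[y yh]; rewrite ev0; exists y. Qed.

Lemma rootsp_ev a w :
  reflect (forall y, y \in h -> br y w = ev a y *: w) (w \in gsp a).
Proof. by rewrite gspE; apply: (iffP (rootspP lieP a w)) => H y /H. Qed.

Lemma brE a y w : w \in gsp a -> y \in h -> br y w = ev a y *: w.
Proof. by move=> /rootsp_ev H /H. Qed.

Lemma rootsp0 : gsp (0 : hdual h) = h.
Proof.
by rewrite gspE; apply/vspaceP => w; exact: (mem_rootsp0 lieP ssP subh solvh nilh normh).
Qed.

Lemma rootsp_br a b x y : x \in gsp a -> y \in gsp b ->
  br x y \in gsp (a + b).
Proof.
move=> xa yb; apply/rootsp_ev => z zh.
by rewrite (br_jacobi lieP) (brE xa zh) (brE yb zh) (brZl lieP) (brZr lieP) -scalerDl evD.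
Qed.

Lemma rootsp_stable a : stable br h (gsp a).
Proof. by move=> y w yh wa; rewrite (brE wa) // rpredZ. Qed.

Lemma rootsp_sum_stable (s : seq (hdual h)) (F : hdual h -> hdual h) :
  stable br h (\sum_(a <- s) gsp (F a)).
Proof.
elim: s => [|a s IHs]; last first.
  by rewrite big_cons; apply: (stable_add lieP) => //; exact: rootsp_stable.
by move=> y w _; rewrite big_nil memv0 => /eqP ->; rewrite (br0r lieP) mem0v.
Qed.

Lemma kappa_rootsp a b x y : x \in gsp a -> y \in gsp b -> a + b != 0 ->
  kappa x y = 0.
Proof.
move=> xa yb /ev_neq0[z zh]; rewrite evD => /negPf abz.
have /eqP := kappa_br lieP z x y.
rewrite (kappaC br z) (kappa_br lieP) [br x y](brC lieP).
have := kappa_br lieP x z y; rewrite [br x z](brC lieP) (brE xa zh) (brE yb zh).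
rewrite (kappaNl lieP) (kappaZl lieP) (kappaZr lieP) => /eqP.
by rewrite eq_sym -subr_eq0 opprK -mulrDl addrC mulf_eq0 abz => /eqP.
Qed.

Lemma rootsp_nonroot a : a != 0 -> ~~ root a -> gsp a = 0%VS.
Proof. by rewrite rtE => -> /=; rewrite negbK => /eqP. Qed.

(** All weights of h on g; [undup] since [rs] may repeat a root. *)
Let W := 0 :: undup rs.

Lemma weights_uniq : uniq W.
Proof.
by rewrite /= undup_uniq mem_undup rsP rtE eqxx.
Qed.

Lemma mem_weights a : (a \in W) = (a == 0) || root a.
Proof. by rewrite inE mem_undup rsP. Qed.

Lemma rootsp_notin_weights a : a \notin W -> gsp a = 0%VS.
Proof. by rewrite mem_weights negb_or => /andP[/rootsp_nonroot]. Qed.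

Lemma weight_space_sum : (\sum_(a <- W) gsp a)%VS = fullv.
Proof.
apply/eqP; rewrite eqEsubv subvf /=; apply/subvP => v _.
have [|ws -> Hws] :=
  joint_eigenvectors lieP ssP subh solvh nilh normh (bs := vbasis h) v.
  by move=> w; apply: vbasis_mem.
rewrite big_seq; apply: rpred_sum => w wws.
have [->|w0] := eqVneq w 0; first exact: mem0v.
have [|a] := joint_eigenvector_rootsp lieP (h := h) w0.
  move=> y yh.
  have Hc i : exists k : C, br (vbasis h)`_i w = k *: w.
    have [ih|ih] := ltnP i (\dim h); last first.
      by exists 0; rewrite nth_default ?size_tuple // (br0l lieP) scale0r.
    by apply: Hws => //; rewrite mem_nth // size_tuple.
  have [k Hk] := choice Hc.
  exists (\sum_(i < \dim h) coord (vbasis h) i y * k i).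
  rewrite {1}(coord_vbasis yh) scaler_suml.
  elim/big_rec2: _ => [|i s t _ <-]; first exact: (br0l lieP).
  by rewrite (brDl lieP) (brZl lieP) Hk scalerA.
rewrite -gspE => wa; have aW : a \in W.
  apply: contraNT w0 => /rootsp_notin_weights a0.
  by rewrite a0 memv0 in wa.
by rewrite (big_rem a) //= -[w]addr0 memv_add ?mem0v.
Qed.

Lemma rootsp_cap_sum b (s : seq (hdual h)) : b \notin s ->
  (gsp b :&: \sum_(a <- s) gsp a = 0)%VS.
Proof.
move=> bs; apply/eqP; rewrite -subv0; apply/subvP => v /memv_capP[vb].
elim: s bs v vb => [|a s IHs] /=; first by rewrite big_nil.
rewrite inE negb_or big_cons => /andP[ba bs] v vb.
case/memv_addP => u ua [w ws ev'].
have [y yh aby] := ev_neq ba.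
have H1 : (ev b y - ev a y) *: v \in gsp b by rewrite rpredZ.
have H2 : (ev b y - ev a y) *: v \in (\sum_(c <- s) gsp c)%VS.
  have -> : (ev b y - ev a y) *: v = br y w - ev a y *: w.
    rewrite scalerBl -(brE vb yh) {1 2}ev' (brDr lieP) (brE ua yh) scalerDr.
    by rewrite opprD addrACA subrr add0r.
  by rewrite rpredB ?rpredZ //; apply: (@rootsp_sum_stable s id).
have := IHs bs _ H1 H2.
by rewrite !memv0 scaler_eq0 subr_eq0 (negPf aby).
Qed.

Lemma dim_rootsp_sum (s : seq (hdual h)) : uniq s ->
  \dim (\sum_(a <- s) gsp a) = (\sum_(a <- s) \dim (gsp a))%N.
Proof.
elim: s => [|a s IHs] /=; first by rewrite !big_nil dimv0.
by case/andP=> /rootsp_cap_sum as0 us; rewrite !big_cons dimv_disjoint_sum // IHs.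
Qed.

(** Applying ad y - a(y) to the sum kills the component of a and rescales the others, so induction
    puts those in U; the one of a is the difference. *)
Lemma stable_components U (s : seq (hdual h)) (vs : hdual h -> g) :
  stable br h U -> uniq s -> (forall a, a \in s -> vs a \in gsp a) ->
  \sum_(a <- s) vs a \in U -> forall a, a \in s -> vs a \in U.
Proof.
move=> hU; have [n] := ubnP (size s); elim: n s vs => // n IHn s vs.
case: s => [//|a s]; rewrite ltnS => /= sn /andP[as' us] Hvs sumU.
have sU b : b \in s -> vs b \in U.
  move=> bs; have [y yh aby] : exists2 y, y \in h & ev b y != ev a y.
    by apply: ev_neq; apply: contraNneq as' => <-.
  have bH c : c \in s -> vs c \in gsp c by move=> cs; apply: Hvs; rewrite inE cs orbT.
  have : (ev b y - ev a y) *: vs b \in U.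
    apply: (IHn s (fun c => (ev c y - ev a y) *: vs c)) => // [c cs|].
      by rewrite rpredZ ?bH.
    have -> : \sum_(c <- s) (ev c y - ev a y) *: vs c =
       br y (\sum_(c <- a :: s) vs c) - ev a y *: (\sum_(c <- a :: s) vs c).
      rewrite big_cons (brDr lieP) (brE (Hvs a _) yh) ?mem_head // scalerDr opprD.
      rewrite addrACA subrr add0r -(adE lieP) linear_sum scaler_sumr -sumrB /=.
      rewrite big_seq [RHS]big_seq; apply: eq_bigr => c cs.
      by rewrite (adE lieP) (brE (bH c cs) yh) scalerBl.
    by rewrite rpredB ?rpredZ ?hU.
  by move/(rpredZ (ev b y - ev a y)^-1); rewrite scalerK ?subr_eq0.
move=> b; rewrite inE => /orP[/eqP->|/sU //].
have -> : vs a = \sum_(c <- a :: s) vs c - \sum_(c <- s) vs c.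
  by rewrite big_cons addrK.
by rewrite rpredB // big_seq rpred_sum.
Qed.

Lemma weight_decomposition v : exists2 vs : hdual h -> g,
  v = \sum_(a <- W) vs a & forall a, vs a \in gsp a.
Proof.
have : v \in (\sum_(a <- W) gsp a)%VS by rewrite weight_space_sum memvf.
elim: W weights_uniq v => [_|a s IHs /= /andP[as' us]] v.
  by rewrite big_nil memv0 => /eqP ->; exists (fun=> 0) => [|a]; rewrite ?big_nil ?mem0v.
rewrite big_cons => /memv_addP[u ua [w ws ->]].
have [vs -> Hvs] := IHs us w ws.
exists (fun b => if b == a then u else vs b) => [|b]; last first.
  by case: eqP => [->|].
rewrite big_cons eqxx; congr (_ + _); rewrite big_seq [RHS]big_seq.
by apply: eq_bigr => b bs; case: eqP => // ba; rewrite -ba bs in as'.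
Qed.

Lemma trv_rootsp_sum (s : seq (hdual h)) (f : 'End(g)) (k : hdual h -> C) :
  uniq s -> (forall a w, a \in s -> w \in gsp a -> f w = k a *: w) ->
  trv (\sum_(a <- s) gsp a) f = \sum_(a <- s) k a * (\dim (gsp a))%:R.
Proof.
elim: s => [|a s IHs] /=; first by rewrite !big_nil trv0.
case/andP=> as' us Hf.
have Hs b w : b \in s -> w \in gsp b -> f w = k b *: w.
  by move=> bs; apply: Hf; rewrite inE bs orbT.
rewrite !big_cons addvC (@trv_addv _ _ _ _ _ (k a)).
- by rewrite IHs // addrC.
- by rewrite capvC rootsp_cap_sum.
- move=> u; elim: (s) Hs u => [|b t IHt] Ht u.
    by rewrite big_nil memv0 => /eqP ->; rewrite linear0 mem0v.
  rewrite big_cons => /memv_addP[w wb [w' wt ->]].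
  rewrite linearD /= memv_add //.
    by rewrite (Ht b) ?mem_head // rpredZ.
  by apply: IHt wt => c z ct; apply: Ht; rewrite inE ct orbT.
- by move=> w wa; apply: Hf; rewrite ?mem_head.
Qed.

Lemma rootsp_dual a x : x \in gsp a -> x != 0 ->
  exists2 y, y \in gsp (- a) & kappa x y = 1.
Proof.
move=> xa x0.
have [y yx] : exists y, kappa x y != 0.
  apply: contrapT => nex; case/eqP: x0; apply: (kappa_nondeg lieP ssP) => y.
  by rewrite kappaC; apply: contrapT => /eqP xy; apply: nex; exists y.
have [ys ey Hys] := weight_decomposition y.
have [|xy0] := eqVneq (kappa x (ys (- a))) 0; last first.
  exists ((kappa x (ys (- a)))^-1 *: ys (- a)); first by rewrite rpredZ.
  by rewrite (kappaZr lieP) mulVf.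
move=> xy0; case/eqP: yx; rewrite ey.
elim: W => [|b s IHs]; first by rewrite big_nil (kappa0r lieP).
rewrite big_cons (kappaDr lieP) IHs addr0.
have [ab|ab] := eqVneq (a + b) 0; last exact: (kappa_rootsp xa (Hys b)).
by have -> : b = - a by apply/eqP; rewrite -addr_eq0 addrC ab.
Qed.

Lemma rootN a : root a -> root (- a).
Proof.
rewrite !rtE => /andP[a0 ra]; rewrite oppr_eq0 a0 /=.
have x0 : vpick (gsp a) != 0 by rewrite vpick0.
have [y ya xy] := rootsp_dual (memv_pick _) x0.
apply: contraTneq ya => ->; rewrite memv0.
by apply: contra_eqN xy => /eqP ->; rewrite (kappa0r lieP) eq_sym oner_eq0.
Qed.

(** * Killing duals of weights and the form on the dual of h *)

Lemma ex_kappa_dual a : exists t, t \in h /\ forall y, y \in h -> kappa t y = ev a y.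
Proof.
have [|t th Ht] := kappa_represents lieP (ev_linear a) (U := h).
  exact: (cartan_kappa_nondeg lieP ssP subh solvh nilh normh).
by exists t.
Qed.

Definition kdual a : g := sval (cid (ex_kappa_dual a)).

Lemma kdual_mem a : kdual a \in h.
Proof. by rewrite /kdual; case: cid => t []. Qed.

Lemma kappa_kdual a y : y \in h -> kappa (kdual a) y = ev a y.
Proof. by move=> yh; rewrite /kdual; case: cid => t [_ /= ->]. Qed.

Lemma kdual_unique a t : t \in h -> (forall y, y \in h -> kappa t y = ev a y) ->
  t = kdual a.
Proof.
move=> th Ht; apply/eqP; rewrite -subr_eq0; apply/eqP.
apply: (cartan_kappa_nondeg lieP ssP subh solvh nilh normh).
  by rewrite rpredB ?kdual_mem.
move=> y yh; rewrite kappaC (kappaDl lieP) (kappaNl lieP) kappa_kdual // Ht //.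
exact: subrr.
Qed.

Lemma kdualD a b : kdual (a + b) = kdual a + kdual b.
Proof.
apply/esym/kdual_unique; first by rewrite rpredD ?kdual_mem.
by move=> y yh; rewrite (kappaDl lieP) !kappa_kdual // evD.
Qed.

Lemma kdualN a : kdual (- a) = - kdual a.
Proof.
apply/esym/kdual_unique; first by rewrite rpredN kdual_mem.
by move=> y yh; rewrite (kappaNl lieP) kappa_kdual // evN.
Qed.

Definition rform a b : C := ev a (kdual b).

Lemma rformC a b : rform a b = rform b a.
Proof.
by rewrite /rform -!kappa_kdual ?kdual_mem // kappaC.
Qed.

Lemma rformDr a b c : rform a (b + c) = rform a b + rform a c.
Proof. by rewrite /rform kdualD evDr. Qed.

Lemma rformDl a b c : rform (a + b) c = rform a c + rform b c.
Proof. by rewrite /rform evD. Qed.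

Lemma br_opposite a x y : x \in gsp a -> y \in gsp (- a) ->
  br x y = kappa x y *: kdual a.
Proof.
move=> xa ya.
have xyh : br x y \in h by rewrite -rootsp0 -(subrr a) rootsp_br.
have [k0|k0] := eqVneq (kappa x y) 0.
  rewrite k0 scale0r; apply: (cartan_kappa_nondeg lieP ssP subh solvh nilh normh) => //.
  move=> z zh; rewrite kappaC (kappa_br lieP) [br y z](brC lieP) (brE ya zh).
  by rewrite (kappaNr lieP) (kappaZr lieP) k0 mulr0 oppr0.
rewrite -[br x y](scalerKV k0); congr (_ *: _); apply: kdual_unique.
  by rewrite rpredZ.
move=> z zh; rewrite (kappaZl lieP) (kappa_br lieP) [br y z](brC lieP) (brE ya zh).
by rewrite (kappaNr lieP) (kappaZr lieP) evN mulNr opprK mulrC mulfK.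
Qed.

(** * Root strings *)

Lemma mulrn_weight_inj a : a != 0 -> injective (fun n => a *+ n).
Proof.
move=> /ev_neq0[y _ ay] m n /(congr1 (ev^~ y)); rewrite /= !evMn.
exact: mulrIn.
Qed.

Lemma weights_escape a b : a != 0 -> exists n, gsp (b + a *+ n) = 0%VS.
Proof.
move=> a0; apply: contrapT => nex.
pose s := [seq b + a *+ n | n <- iota 0 (size W).+1].
have us : uniq s.
  by rewrite map_inj_uniq ?iota_uniq // => m n /addrI; apply: mulrn_weight_inj.
have sW : {subset s <= W}.
  move=> _ /mapP[n _ ->]; apply: contraT => /rootsp_notin_weights nW.
  by case: nex; exists n.
by have := uniq_leq_size us sW; rewrite size_map size_iota ltnn.
Qed.

Lemma gsp_sub_sum b (s : seq (hdual h)) : b \in s -> (gsp b <= \sum_(a <- s) gsp a)%VS.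
Proof. by move=> bs; rewrite (big_rem b) //= addvSl. Qed.

Lemma gsp_sum_map (s : seq (hdual h)) (f : 'End(g)) U :
  (forall a w, a \in s -> w \in gsp a -> f w \in U) ->
  forall u, u \in (\sum_(a <- s) gsp a)%VS -> f u \in U.
Proof.
elim: s => [|a s IHs] Hf u.
  by rewrite big_nil memv0 => /eqP ->; rewrite linear0 mem0v.
rewrite big_cons => /memv_addP[v va [w ws ->]]; rewrite linearD rpredD //.
  by apply: Hf va; rewrite mem_head.
by apply: IHs ws => b z bs; apply: Hf; rewrite inE bs orbT.
Qed.

Lemma trv_br0 U x y : (forall u, u \in U -> br x u \in U) ->
  (forall u, u \in U -> br y u \in U) -> trv U (ad (br x y)) = 0.
Proof.
move=> xU yU; rewrite (ad_br lieP) linearB /= trv_comm ?subrr // => u uU.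
  by rewrite adE ?xU.
by rewrite adE ?yU.
Qed.

(** The string spans a subspace stable under x and y, where their commutator has trace 0. This
    identity takes the place of the representation theory of sl2. *)
Lemma string_trace a c x y m : a != 0 -> x \in gsp a -> y \in gsp (- a) ->
    (forall z, z \in gsp c -> br y z = 0) ->
    (forall z, z \in gsp (c + a *+ m) -> br x z = 0) ->
  \sum_(i < m.+1) ev (c + a *+ i) (br x y) * (\dim (gsp (c + a *+ i)))%:R = 0.
Proof.
move=> a0 xa ya bot top; pose s := [seq c + a *+ i | i <- iota 0 m.+1].
have us : uniq s.
  by rewrite map_inj_uniq ?iota_uniq // => i j /addrI; apply: mulrn_weight_inj.
have th : br x y \in h by rewrite -rootsp0 -(subrr a) rootsp_br.
have ins i : (i <= m)%N -> c + a *+ i \in s.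
  by move=> im; apply/mapP; exists i; rewrite ?mem_iota.
transitivity (trv (\sum_(b <- s) gsp b) (ad (br x y))).
  rewrite (@trv_rootsp_sum s _ (ev^~ (br x y))) //; last first.
    by move=> b w _ wb; rewrite (adE lieP) (brE wb).
  rewrite big_map -(big_mkord xpredT
    (fun i => ev (c + a *+ i) (br x y) * (\dim (gsp (c + a *+ i)))%:R)).
  by rewrite /index_iota subn0.
apply: trv_br0.
  move=> u us'; rewrite -(adE lieP); move: u us'; apply: gsp_sum_map.
  move=> _ w /mapP[i + ->] wi; rewrite mem_iota /= add0n ltnS leq_eqVlt (adE lieP).
  case/orP => [/eqP ei|im]; first by rewrite top ?mem0v // -ei.
  apply: (subvP (gsp_sub_sum (ins i.+1 im))).
  by rewrite mulrS addrCA; apply: rootsp_br.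
move=> u us'; rewrite -(adE lieP); move: u us'; apply: gsp_sum_map.
move=> _ w /mapP[i + ->] wi; rewrite mem_iota /= add0n ltnS (adE lieP).
case: i wi => [|i] wi im; first by rewrite bot ?mem0v // -[c]addr0.
apply: (subvP (gsp_sub_sum (ins i (ltnW im)))).
have -> : c + a *+ i = - a + (c + a *+ i.+1).
  by rewrite mulrS addrCA addKr.
exact: rootsp_br.
Qed.

Lemma root_neq0 a : root a -> a != 0.
Proof. by rewrite rtE => /andP[]. Qed.

Lemma dim_root_gt0 a : root a -> (0 < \dim (gsp a))%N.
Proof. by rewrite rtE lt0n dimv_eq0 => /andP[]. Qed.

(** If a vanished on its dual t, the trace along the a-string of a root b would be b(t) times a
    positive dimension. Every root would vanish on t, so ad t = 0, t = 0 and a = 0. *)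
Lemma rform_neq0 a : root a -> rform a a <> 0.
Proof.
move=> ra aa0; have a0 := root_neq0 ra.
have x0 : vpick (gsp a) != 0.
  by rewrite vpick0 -dimv_eq0 -lt0n dim_root_gt0.
have [y ya xy] := rootsp_dual (memv_pick _) x0.
have et := br_opposite (memv_pick _) ya; rewrite xy scale1r in et.
have bt0 b : root b -> ev b (kdual a) = 0.
  move=> rb; have na0 : - a != 0 by rewrite oppr_eq0.
  have [n1 Hn1] := weights_escape b na0; have [n2 Hn2] := weights_escape b a0.
  (* The string runs between two zero weight spaces, so both end conditions are trivial. *)
  pose c := b + (- a) *+ n1.
  have ec i : c + a *+ (n1 + i) = b + a *+ i by rewrite /c mulrnDr addrA mulNrn subrK.
  have z0 d z : gsp d = 0%VS -> z \in gsp d -> z = 0.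
    by move=> ->; rewrite memv0 => /eqP.
  have := @string_trace a c _ y (n1 + n2) a0 (memv_pick _) ya.
  rewrite et (eq_bigr (fun i : 'I_(n1 + n2).+1 =>
     ev b (kdual a) * (\dim (gsp (c + a *+ i)))%:R)); last first.
    move=> i _; rewrite /c !evD !evMn evN -[ev a (kdual a)]/(rform a a) aa0.
    by rewrite oppr0 !mul0rn !addr0.
  rewrite -mulr_sumr -natr_sum => H.
  have /eqP : ev b (kdual a) * (\sum_(i < (n1 + n2).+1) \dim (gsp (c + a *+ i)%R))%:R = 0.
    apply: H => z; first by move=> /(z0 _ _ Hn1) ->; rewrite (br0r lieP).
    by rewrite ec => /(z0 _ _ Hn2) ->; rewrite (br0r lieP).
  rewrite mulf_eq0 => /orP[/eqP //|]; rewrite pnatr_eq0 sum_nat_eq0.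
  have ltn1 : (n1 < (n1 + n2).+1)%N by rewrite ltnS leq_addr.
  move=> /forallP/(_ (Ordinal ltn1)) /=.
  rewrite -[n1 in X in gsp X]addn0 ec addr0 => /eqP d0.
  by have := dim_root_gt0 rb; rewrite d0.
have t0 : kdual a = 0.
  apply: (kappa_nondeg lieP ssP) => z.
  rewrite (_ : kappa z _ = ltr (ad z \o ad (kdual a))%VF) //.
  rewrite (_ : ad (kdual a) = 0) ?comp_lfun0r ?linear0 //.
  apply/lfunP => v; rewrite zero_lfunE (adE lieP).
  have [vs -> Hvs] := weight_decomposition v.
  rewrite -(adE lieP) linear_sum big1_seq //= => b bW.
  rewrite (adE lieP) (brE (Hvs b) (kdual_mem a)); have := mem_weights b.
  by rewrite bW => /esym/orP[/eqP ->|/bt0 ->]; rewrite ?ev0 scale0r.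
have [z zh] := ev_neq0 a0.
by rewrite -kappa_kdual // t0 (kappa0l lieP) eqxx.
Qed.

(** * Coroots, sl2-triples and root strings *)

Definition coroot a : g := (2 / rform a a) *: kdual a.

Lemma coroot_mem a : coroot a \in h.
Proof. by rewrite rpredZ ?kdual_mem. Qed.

Lemma ev_coroot a b : ev b (coroot a) = 2 / rform a a * rform b a.
Proof. by rewrite /coroot evZr. Qed.

Lemma ev_corootxx a : root a -> ev a (coroot a) = 2.
Proof. by move=> /rform_neq0/eqP r0; rewrite ev_coroot mulfVK. Qed.

Lemma corootN a : coroot (- a) = - coroot a.
Proof.
by rewrite /coroot kdualN scalerN /rform kdualN evN evNr opprK.
Qed.

Lemma sl2_triple a : root a -> exists x y,
  [/\ x \in gsp a, y \in gsp (- a), x <> 0, y <> 0 & br x y = coroot a].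
Proof.
move=> ra; have x0 : vpick (gsp a) != 0.
  by rewrite vpick0 -dimv_eq0 -lt0n dim_root_gt0.
have [y ya xy] := rootsp_dual (memv_pick _) x0.
have k0 : 2 / rform a a != 0 :> C.
  rewrite mulf_neq0 ?invr_eq0 ?pnatr_eq0 //.
  by apply/eqP/rform_neq0.
exists (vpick (gsp a)), ((2 / rform a a) *: y); split.
- exact: memv_pick.
- by rewrite rpredZ.
- exact/eqP.
- apply/eqP; rewrite scaler_eq0 (negPf k0) /=.
  by apply: contra_eqN xy => /eqP ->; rewrite (kappa0r lieP) eq_sym oner_eq0.
- by rewrite (brZr lieP) (br_opposite (memv_pick _) ya) xy scale1r.
Qed.

(** The sum V of the spaces g^(ka), k = 1..n, the line of t = [x, y] and the line of y is stable
    under x and y. The trace of t on V is 2 sum k dim g^(ka) + 0 - 2, and it vanishes. This gives at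
    once that g^a is a line and that no further multiple of a is a root. *)
Lemma dim_multiples a n : root a -> gsp (a *+ n.+1) = 0%VS ->
  (\sum_(i < n) \dim (gsp (a *+ i.+1)) * i.+1 = 1)%N.
Proof.
move=> ra an0; have a0 := root_neq0 ra.
have [x [y [xa ya x0 y0 et]]] := sl2_triple ra.
set t := coroot a in et; have th : t \in h := coroot_mem a.
have at2 : ev a t = 2 := ev_corootxx ra.
have [l0 el] : exists l0 : C, kdual a = l0 *: t.
  exists (2 / rform a a)^-1; rewrite scalerK // mulf_neq0 ?invr_eq0 ?pnatr_eq0 //.
  exact/eqP/rform_neq0.
clearbody t.
pose s := [seq a *+ i.+1 | i <- iota 0 n].
pose S := (\sum_(b <- s) gsp b)%VS.
have us : uniq s.
  rewrite map_inj_uniq ?iota_uniq // => i j /(mulrn_weight_inj a0); exact: succn_inj.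
have ins i : (i < n)%N -> (gsp (a *+ i.+1) <= S)%VS.
  by move=> im; apply: gsp_sub_sum; apply/mapP; exists i; rewrite ?mem_iota.
have n_gt0 : (0 < n)%N.
  case: (n) an0 => // a1; have := dim_root_gt0 ra.
  by rewrite -[a]/(a *+ 1) a1 dimv0.
have ev_t0 : t <> 0.
  move=> t0; have := at2; rewrite t0.
  have -> : ev a 0 = 0 by rewrite -[0 in LHS](scale0r (0 : g)) evZr mul0r.
  by move/esym/eqP; rewrite pnatr_eq0.
have ns0 : 0 \notin s.
  apply/mapP => -[i _ /esym/eqP]; rewrite -[0](mulr0n a).
  by move/eqP/(mulrn_weight_inj a0).
have tS : t \notin S.
  apply/negP => tS; apply: ev_t0; apply/eqP; rewrite -memv0.
  by rewrite -(rootsp_cap_sum ns0) memv_cap rootsp0 th.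
have yS : y \notin (S + <[t]>)%VS.
  apply/negP => yS; apply: y0; apply/eqP; rewrite -memv0.
  have nas : - a \notin 0 :: s.
    rewrite inE oppr_eq0 negb_or a0 /=; apply/mapP => -[i _ e].
    have : a *+ i.+2 = a *+ 0 by rewrite mulrS -e subrr.
    by move/(mulrn_weight_inj a0).
  rewrite -(rootsp_cap_sum nas) memv_cap ya big_cons rootsp0.
  move: yS; apply: subvP; rewrite subv_add addvSr /= -memvE.
  exact: (subvP (addvSl _ _)).
have Sst u : u \in S -> br t u \in S by apply: (@rootsp_sum_stable s id).
pose V := (S + <[t]> + <[y]>)%VS.
have SV : (S <= V)%VS by rewrite /V -addvA addvSl.
have tV : t \in V by rewrite /V (subvP (addvSl _ _)) // (subvP (addvSr _ _)) // memv_line.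
have yV : y \in V by rewrite /V (subvP (addvSr _ _)) // memv_line.
have Vmap z : (forall u, u \in S -> br z u \in V) -> br z t \in V -> br z y \in V ->
    forall u, u \in V -> br z u \in V.
  move=> zS zt zy _ /memv_addP[_ /memv_addP[u uS [_ /vlineP[k ->] ->]] [_ /vlineP[l ->] ->]].
  rewrite !(brDr lieP) !(brZr lieP); have := zS u uS.
  move=> zuV; exact: (memvD (memvD zuV (memvZ k zt)) (memvZ l zy)).
have aS : (gsp a <= S)%VS := ins 0%N n_gt0.
have xV : forall u, u \in V -> br x u \in V.
  apply: Vmap; last by rewrite et.
    move=> u uS; rewrite -(adE lieP); move: u uS; apply: gsp_sum_map.
    move=> _ w /mapP[i + ->] wi; rewrite mem_iota /= add0n (adE lieP) => im.
    have wi' : br x w \in gsp (a *+ i.+2) by rewrite mulrS; apply: rootsp_br.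
    have [im'|] := ltnP i.+1 n; first exact: (subvP (subv_trans (ins _ im') SV)).
    rewrite leq_eqVlt ltnS leqNgt im orbF => /eqP e.
    by move: wi'; rewrite -e an0 memv0 => /eqP ->; apply: mem0v.
  rewrite (brC lieP) (brE xa th) rpredN rpredZ //.
  exact: (subvP (subv_trans aS SV)).
have yVs : forall u, u \in V -> br y u \in V.
  apply: Vmap; last by rewrite (brxx lieP) mem0v.
    move=> u uS; rewrite -(adE lieP); move: u uS; apply: gsp_sum_map.
    move=> _ w /mapP[i + ->] wi; rewrite mem_iota /= add0n (adE lieP) => im.
    case: i wi im => [|i] wi im.
      by rewrite (brC lieP) (br_opposite wi ya) el rpredN !rpredZ.
    apply: (subvP (subv_trans (ins _ (ltnW im)) SV)).
    by rewrite -[a *+ i.+1](addKr a) -mulrS; apply: rootsp_br.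
  by rewrite (brC lieP) (brE ya th) rpredN rpredZ.
have := trv_br0 xV yVs; rewrite et.
rewrite (@trv_quot _ _ (S + <[t]>)%VS V _ (ev (- a) t)) ?addvSl //; last first.
  move=> _ /memv_addP[w wS [_ /vlineP[l ->] ->]].
  rewrite (adE lieP) (brDr lieP) (brZr lieP) (brE ya th) scalerDr opprD.
  rewrite addrACA [l *: (_ *: y)]scalerA [l * _]mulrC -scalerA subrr addr0 rpredB ?rpredZ //.
  case/memv_addP: wS => u uS [_ /vlineP[k ->] ->].
  rewrite (brDr lieP) (brZr lieP) (brxx lieP) scaler0 addr0.
  exact: (subvP (addvSl _ _) _ (Sst u uS)).
rewrite (@trv_quot _ _ S (S + <[t]>)%VS _ 0) ?addvSl //; last first.
  move=> w /memv_addP[u uS [_ /vlineP[k ->] ->]].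
  by rewrite scale0r subr0 (adE lieP) (brDr lieP) (brZr lieP) (brxx lieP) scaler0 addr0 Sst.
rewrite mul0r addr0 (dimv_add_line yS) subSnn mulr1 evN at2.
rewrite (@trv_rootsp_sum s _ (ev^~ t)) //; last first.
  by move=> b w _ wb; rewrite (adE lieP) (brE wb).
rewrite big_map (eq_bigr (fun i => 2 * (\dim (gsp (a *+ i.+1)) * i.+1)%:R)); last first.
  move=> i _; rewrite evMn at2; move: (2 : C) => c.
  by rewrite -[c *+ _]mulr_natr -mulrA -natrM mulnC.
rewrite -mulr_sumr -natr_sum => /eqP; rewrite subr_eq0 -{2}[2]mulr1.
have two : (2 : C) != 0 by rewrite pnatr_eq0.
move=> /eqP/(mulfI two)/eqP; rewrite -[1]/(1%:R) eqr_nat => /eqP <-.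
by rewrite -(big_mkord xpredT (fun i => \dim (gsp (a *+ i.+1)) * i.+1)%N) /index_iota subn0.
Qed.

Lemma dim_root a : root a -> \dim (gsp a) = 1%N.
Proof.
move=> ra; have d0 := dim_root_gt0 ra.
have [n] := weights_escape a (root_neq0 ra); rewrite -mulrS => an0.
have := dim_multiples ra an0; case: n an0 => [|n] _; first by rewrite big_ord0.
rewrite big_ord_recl muln1; case: (\dim _) d0 => // d _.
by rewrite addSn => -[] /eqP; rewrite addn_eq0 => /andP[/eqP ->].
Qed.

Lemma multiple_not_root a k : root a -> gsp (a *+ k.+2) = 0%VS.
Proof.
move=> ra; have [m] := weights_escape (a *+ k.+2) (root_neq0 ra).
rewrite -mulrnDr; case: m => [|m]; first by rewrite addn0.
rewrite addnS => an0; apply/eqP; rewrite -dimv_eq0.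
have := dim_multiples ra an0.
have lt0 : (0 < k.+2 + m)%N by [].
have ltk : (k.+1 < k.+2 + m)%N by rewrite addSn ltnS leq_addr.
rewrite (bigD1 (Ordinal lt0)) //= (bigD1 (Ordinal ltk)) //= dim_root // mul1n.
by rewrite add1n => -[] /eqP; rewrite addn_eq0 muln_eq0 orbF => /andP[].
Qed.

Lemma weight_multiple_neq0 a b i : root a -> root b -> b != - a ->
  b + a *+ i != 0.
Proof.
move=> ra rb ba; rewrite addrC addr_eq0; case: i => [|[|i]].
- by rewrite mulr0n eq_sym oppr_eq0 root_neq0.
- by rewrite mulr1n -eqr_oppLR eq_sym.
- apply/eqP => e; have := multiple_not_root i ra; rewrite e => b0.
  by have := dim_root_gt0 (rootN rb); rewrite b0 dimv0.
Qed.

Lemma string_end a b : root a -> root b -> b != - a ->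
  exists q, gsp (b + a *+ q.+1) = 0%VS /\
    forall i, (i <= q)%N -> root (b + a *+ i).
Proof.
move=> ra rb ba; have [m Hm] := weights_escape b (root_neq0 ra).
have ex : exists n, gsp (b + a *+ n) == 0%VS by exists m; rewrite Hm.
case: (ex_minnP ex) => -[|q] /eqP Hq minq.
  by have := dim_root_gt0 rb; rewrite -[b]addr0 Hq dimv0.
exists q; split=> // i iq; rewrite rtE weight_multiple_neq0 //=.
by apply/negP => /minq; rewrite leqNgt ltnS iq.
Qed.

Lemma sum_arith (F : comNzRingType) (x : F) n :
  \sum_(i < n.+1) (x + 2 * i%:R) = n.+1%:R * (x + n%:R).
Proof.
elim: n => [|n IHn]; first by rewrite big_ord1 mulr0 mul1r.
rewrite big_ord_recr /= IHn -[n.+2%:R]natr1 -[n.+1%:R]natr1; move: n%:R => k; ring.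
Qed.

Let string_id (F : comNzRingType) (x p m : F) :
  x - (p - m) = x - 2 * p + (p + m).
Proof. by ring. Qed.

Let form_id (F : comNzRingType) (x y : F) : x + y + (y + x) = 2 * x + 2 * y.
Proof. by ring. Qed.

(** All spaces are lines, so the zero trace is the sum of a progression from b(t) - 2p to b(t) + 2m.
    The top only has to be killed by x, which [br_root_neq0] exploits. *)
Lemma string_value a b (p m : nat) x y : root a -> x \in gsp a -> y \in gsp (- a) ->
    br x y = coroot a ->
    (forall i, (i <= p + m)%N -> root (b + (- a) *+ p + a *+ i)) ->
    (forall z, z \in gsp (b + (- a) *+ p) -> br y z = 0) ->
    (forall z, z \in gsp (b + (- a) *+ p + a *+ (p + m)) -> br x z = 0) ->
  ev b (coroot a) = p%:R - m%:R.
Proof.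
move=> ra xa ya et rs' bot top.
have := string_trace (root_neq0 ra) xa ya bot top; rewrite et.
rewrite (eq_bigr (fun i : 'I_(p + m).+1 => (ev b (coroot a) - 2 * p%:R) + 2 * i%:R)).
  rewrite sum_arith => /eqP; rewrite mulf_eq0 pnatr_eq0 /= natrD => /eqP e.
  by apply/eqP; rewrite -subr_eq0 string_id e.
move=> i _; have ri : root (b + (- a) *+ p + a *+ i) by apply: rs'; rewrite -ltnS.
rewrite (dim_root ri) mulr1 !evD !evMn evN (ev_corootxx ra).
move: (2 : C) => c.
by rewrite -[c *+ i]mulr_natr -[(- c) *+ p]mulr_natr mulNr.
Qed.

Lemma root_string a b : root a -> root b -> b != a -> b != - a -> exists p q : nat,
  [/\ ev b (coroot a) = p%:R - q%:R,
      gsp (b + (- a) *+ p.+1) = 0%VS, gsp (b + a *+ q.+1) = 0%VS,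
      (forall i, (i <= p)%N -> root (b + (- a) *+ i)) &
      (forall i, (i <= q)%N -> root (b + a *+ i))].
Proof.
move=> ra rb ba bNa; have baN : b != - - a by rewrite opprK.
have [p [Hp rp]] := string_end (rootN ra) rb baN.
have [q [Hq rq]] := string_end ra rb bNa.
exists p, q; split=> //.
have [x [y [xa ya _ _ et]]] := sl2_triple ra.
have shift i : b + (- a) *+ p + a *+ (p + i) = b + a *+ i.
  by rewrite mulrnDr addrA mulNrn subrK.
apply: (string_value ra xa ya et) => [i ipq|z zp|z].
- have [ip|pi] := leqP i p; last by rewrite -(subnKC (ltnW pi)) shift rq // leq_subLR.
  have -> : b + (- a) *+ p + a *+ i = b + (- a) *+ (p - i).
    by rewrite -{1}(subnK ip) mulrnDr addrA !mulNrn subrK.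
  by rewrite rp // leq_subr.
- apply/eqP; rewrite -memv0 -Hp mulrS addrCA; exact: rootsp_br.
- rewrite shift => zq.
  apply/eqP; rewrite -memv0 -Hq mulrS addrCA; exact: rootsp_br.
Qed.

(** If x killed g^b, the string cut off at b would give the pairing p - 0 besides p - q, forcing q =
    0 although a + b is a root. *)
Lemma br_root_neq0 a b : root a -> root b -> root (a + b) ->
  exists x z, [/\ x \in gsp a, z \in gsp b & br x z <> 0].
Proof.
move=> ra rb rab.
have ba : b != a.
  apply: contraTneq rab => ->; rewrite rtE -mulr2n multiple_not_root //.
  by rewrite eqxx andbF.
have bNa : b != - a.
  by apply: contraTneq rab => ->; rewrite rtE subrr eqxx.
have [p [q [e Hp Hq rp _]]] := root_string ra rb ba bNa.
have [x [y [xa ya _ _ et]]] := sl2_triple ra.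
apply: contrapT => nex.
have : ev b (coroot a) = p%:R - 0%:R.
  have shift : b + (- a) *+ p + a *+ (p + 0) = b.
    by rewrite addn0 mulNrn subrK.
  apply: (string_value ra xa ya et) => [i|z zp|z].
  - rewrite addn0 => ip.
    have -> : b + (- a) *+ p + a *+ i = b + (- a) *+ (p - i).
      by rewrite -{1}(subnK ip) mulrnDr addrA !mulNrn subrK.
    by rewrite rp // leq_subr.
  - apply/eqP; rewrite -memv0 -Hp mulrS addrCA; exact: rootsp_br.
  - by rewrite shift => zb; apply: contrapT => xz; apply: nex; exists x, z.
rewrite e => /addrI/eqP; rewrite eqr_opp eqr_nat => /eqP q0.
by have := dim_root_gt0 rab; rewrite addrC -[a]/(a *+ 1) -q0 Hq dimv0.
Qed.

Lemma gsp_add_subv a b U : root a -> root b -> root (a + b) ->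
  subalgebra br U -> (gsp a <= U)%VS -> (gsp b <= U)%VS -> (gsp (a + b)%R <= U)%VS.
Proof.
move=> ra rb rab sU aU bU; have [x [z [xa zb /eqP xz]]] := br_root_neq0 ra rb rab.
have -> : gsp (a + b) = <[br x z]>%VS.
  apply/esym/eqP; rewrite eqEdim dim_root // dim_vline xz -memvE.
  by rewrite rootsp_br.
by rewrite -memvE; apply: sU; [apply: (subvP aU)|apply: (subvP bU)].
Qed.

Lemma ev_coroot_int a b : root a -> root b ->
  exists p q : nat, ev b (coroot a) = p%:R - q%:R.
Proof.
move=> ra rb; have [->|ba] := eqVneq b a.
  by exists 2%N, 0%N; rewrite subr0 ev_corootxx.
have [->|bNa] := eqVneq b (- a).
  by exists 0%N, 2%N; rewrite evN ev_corootxx // sub0r.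
by have [p [q [e _ _ _ _]]] := root_string ra rb ba bNa; exists p, q.
Qed.

(** The trace is a sum of squares of integers, to which a contributes 4. *)
Lemma kappa_coroot_gt0 a : root a -> 0 < kappa (coroot a) (coroot a).
Proof.
move=> ra; rewrite (_ : kappa _ _ = ltr (ad (coroot a) \o ad (coroot a))%VF) //.
rewrite -trv_full -weight_space_sum.
rewrite (@trv_rootsp_sum W _ (fun b => ev b (coroot a) ^+ 2)); last first.
- move=> b w _ wb; rewrite comp_lfunE !(adE lieP) (brE wb (coroot_mem a)).
  by rewrite (brZr lieP) (brE wb (coroot_mem a)) scalerA.
- exact: weights_uniq.
have aW : a \in W by rewrite mem_weights ra orbT.
rewrite (big_rem a aW) ev_corootxx // ltr_pwDl //.
  by rewrite dim_root // mulr1 exprn_gt0.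
rewrite big_seq sumr_ge0 // => b bW; have := mem_rem bW; rewrite mem_weights.
case/orP => [/eqP ->|rb]; first by rewrite ev0 expr0n mul0r.
have [p [q ->]] := ev_coroot_int ra rb.
by rewrite mulr_ge0 // real_exprn_even_ge0 // rpredB // realn.
Qed.

Lemma rform_gt0 a : root a -> 0 < rform a a.
Proof.
move=> ra; have := kappa_coroot_gt0 ra.
rewrite {1}/coroot (kappaZl lieP) kappa_kdual ?coroot_mem // ev_corootxx //.
by rewrite pmulr_lgt0 // pmulr_rgt0 // invr_gt0.
Qed.

(* Otherwise [a + b] would be a root with [rform (a + b) (a + b) <= 0]. *)
Lemma symmetric_pairing_ge a b (p q : nat) : root a -> root b -> b != a -> b != - a ->
  ev a (coroot b) = ev b (coroot a) -> ev b (coroot a) = p%:R - q%:R ->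
  (q <= p.+1)%N.
Proof.
move=> ra rb ba bNa sym e; rewrite leqNgt; apply/negP => pq.
have rab : root (a + b).
  have [p' [q' [e' _ _ _ rq']]] := root_string ra rb ba bNa.
  rewrite addrC -[a]/(a *+ 1) rq' // lt0n; apply/eqP => q0.
  move/eqP: e'; rewrite e q0 subr0 subr_eq -natrD eqr_nat => /eqP ep.
  by move: pq; rewrite ep ltnNge (leq_trans (leq_addl _ _) (leqnSn _)).
have n0 : ev b (coroot a) != 0.
  rewrite e subr_eq0 eqr_nat neq_ltn; apply/orP; left.
  exact: (leq_trans _ pq).
have [a0 b0] := (rform_gt0 ra, rform_gt0 rb).
have eb : 2 * rform b a = (p%:R - q%:R) * rform a a.
  by rewrite -e ev_coroot mulrAC mulfVK ?gt_eqF.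
(* The pairings are 2(a, b)/(a, a) and 2(a, b)/(b, b), equal and nonzero. *)
have eab : rform a a = rform b b.
  have ab0 : rform b a != 0.
    by apply: contra_neq n0 => e0; rewrite ev_coroot e0 mulr0.
  have two : (2 : C) != 0 by rewrite pnatr_eq0.
  move: sym; rewrite !ev_coroot (rformC a b) => /(mulIf ab0)/(mulfI two).
  by move/invr_inj.
have := rform_gt0 rab; rewrite rformDr !rformDl (rformC a b) -eab.
have -> : rform a a + rform b a + (rform b a + rform a a) =
   2 * rform a a + 2 * rform b a by exact: form_id.
rewrite eb -mulrDl pmulr_lgt0 // addrA -natrD subr_gt0 ltr_nat.
by rewrite add2n ltnNge pq.
Qed.

(** * Reflections and closed sets of roots *)

Definition refl a b : hdual h := b - ev b (coroot a) *: a.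

Lemma reflD a b c : refl a (b + c) = refl a b + refl a c.
Proof. by rewrite /refl evD scalerDl opprD addrACA. Qed.
Lemma reflN a b : refl a (- b) = - refl a b.
Proof. by rewrite /refl evN scaleNr -opprD. Qed.
Lemma reflxx a : root a -> refl a a = - a.
Proof.
by move=> ra; rewrite /refl ev_corootxx // scaler_nat mulr2n opprD addrA subrr sub0r.
Qed.

Lemma reflK a : root a -> involutive (refl a).
Proof.
move=> ra b; rewrite {1}/refl {2}/refl evB evZ ev_corootxx //.
by rewrite mulr_natr mulr2n opprD addrA subrr sub0r scaleNr opprK subrK.
Qed.

Lemma refl_root a b : root a -> root b -> root (refl a b).
Proof.
move=> ra rb; have [->|ba] := eqVneq b a; first by rewrite reflxx // rootN.
have [->|bNa] := eqVneq b (- a); first by rewrite reflN reflxx // opprK.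
have [p [q [e _ _ rp rq]]] := root_string ra rb ba bNa.
rewrite /refl e; case: (leqP p q) => pq.
  by rewrite -[p%:R - _]opprB scaleNr opprK -natrB // scaler_nat rq // leq_subr.
by rewrite -natrB 1?ltnW // -scalerN scaler_nat rp // leq_subr.
Qed.

Definition closed_roots (P : pred (hdual h)) :=
  forall a b, root a -> root b -> root (a + b) -> P a -> P b -> P (a + b).

(** r_a b is reached from b by adding a repeatedly, and q - p <= q keeps each intermediate sum in
    the root string. *)
Lemma closed_roots_refl (P : pred (hdual h)) a b : closed_roots P ->
  root a -> root b -> P a -> P b -> ev b (coroot a) <= 0 -> P (refl a b).
Proof.
move=> clP ra rb Pa Pb; have [->|ba] := eqVneq b a.
  by rewrite ev_corootxx // lern0.
have [->|bNa] := eqVneq b (- a); first by rewrite reflN reflxx // opprK.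
have [p [q [e _ _ _ rq]]] := root_string ra rb ba bNa.
rewrite e subr_le0 ler_nat => pq.
rewrite /refl e -[p%:R - _]opprB scaleNr opprK -natrB // scaler_nat.
have : (q - p <= q)%N by rewrite leq_subr.
elim: (q - p)%N => [|i IHi] iq; first by rewrite addr0.
rewrite mulrS addrCA; apply: clP => //.
- by rewrite rq // ltnW.
- by rewrite addrCA -mulrS rq.
- by rewrite IHi // ltnW.
Qed.

Lemma ev_inj a b : (forall y, y \in h -> ev a y = ev b y) -> a = b.
Proof.
move=> e; apply/eqP; apply: contraT => /ev_neq[y yh].
by rewrite e ?eqxx.
Qed.

Lemma refl_opp a b : refl (- a) b = refl a b.
Proof. by rewrite /refl corootN evNr scalerN scaleNr opprK. Qed.

Lemma ev_refl_coroot a b : root a -> ev (refl a b) (coroot a) = - ev b (coroot a).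
Proof.
move=> ra; rewrite /refl evB evZ ev_corootxx // mulr_natr mulr2n.
by rewrite opprD addrA subrr sub0r.
Qed.

(** If the pairing of x with c is nonpositive, adding c moves x to r_c x inside A, and adding -c
    moves r_c x back to x inside B. Otherwise x and r_c x trade places. *)
Lemma refl_exchange (A B : pred (hdual h)) c (x : hdual h) :
    closed_roots A -> closed_roots B -> root c -> A c -> B (- c) -> root x ->
  (A x -> A (refl c x)) /\ (B (refl c x) -> B x) \/
  (A (refl c x) -> A x) /\ (B x -> B (refl c x)).
Proof.
move=> clA clB rc Ac Bc rx; have rNc := rootN rc; have rrx := refl_root rc rx.
have [p [q e]] := ev_coroot_int rc rx.
have eN : ev x (coroot (- c)) = - ev x (coroot c) by rewrite corootN evNr.
have er : ev (refl c x) (coroot c) = - ev x (coroot c) by exact: ev_refl_coroot.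
have erN : ev (refl c x) (coroot (- c)) = ev x (coroot c).
  by rewrite corootN evNr er opprK.
case: (leqP p q) => pq.
  have n0 : ev x (coroot c) <= 0 by rewrite e subr_le0 ler_nat.
  left; split=> [Ax|Bx]; first exact: closed_roots_refl.
  rewrite -[x](reflK rc) -refl_opp; apply: closed_roots_refl => //.
  by rewrite erN.
have n0 : - ev x (coroot c) <= 0 by rewrite e opprB subr_le0 ler_nat ltnW.
right; split=> [Ax|Bx].
  rewrite -[x](reflK rc); apply: closed_roots_refl => //.
  by rewrite er.
by rewrite -refl_opp; apply: closed_roots_refl; rewrite ?eN.
Qed.

(** * The involution induced by the conjugation *)

Variable sigma : g -> g.
Hypothesis sigmaP : antilinear_involution br sigma.
Hypothesis sigmah : forall x, x \in h -> sigma x \in h.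

(** The involution s, extended to all weights; the outer conjugation restores C-linearity. *)
Definition sdual a : hdual h :=
  linfun (fun H : subvs_of h => (ev a (sigma (vsval H)))^* : C^o).

Lemma ev_sdual a y : y \in h -> ev (sdual a) y = (ev a (sigma y))^*.
Proof.
move=> yh; pose f (H : subvs_of h) : C^o := (ev a (sigma (vsval H)))^*.
have linf : linear f.
  move=> k s t; rewrite /f linearP (sigmaD sigmaP) (sigmaZ sigmaP) evDr evZr.
  by rewrite rmorphD rmorphM /= conjCK.
by rewrite /ev /sdual (linfun_linearE linf) /f vsprojK.
Qed.

Lemma sdualK : involutive sdual.
Proof.
move=> a; apply: ev_inj => y yh; rewrite !ev_sdual ?sigmah //.
by rewrite (sigmaK sigmaP) conjCK.
Qed.

Lemma sdualD a b : sdual (a + b) = sdual a + sdual b.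
Proof. by apply: ev_inj => y yh; rewrite evD !ev_sdual // evD rmorphD. Qed.
Lemma sdualN a : sdual (- a) = - sdual a.
Proof. by apply: ev_inj => y yh; rewrite evN !ev_sdual // evN rmorphN. Qed.
Lemma sdualZ k a : sdual (k *: a) = k^* *: sdual a.
Proof. by apply: ev_inj => y yh; rewrite evZ !ev_sdual // evZ rmorphM. Qed.
Lemma sdual0 : sdual 0 = 0.
Proof. by apply: ev_inj => y yh; rewrite ev_sdual // !ev0 rmorph0. Qed.

Lemma sigma_gsp a x : x \in gsp a -> sigma x \in gsp (sdual a).
Proof.
move=> xa; apply/rootsp_ev => y yh.
rewrite -{1}[y](sigmaK sigmaP) -(sigma_br sigmaP) (brE xa (sigmah yh)).
by rewrite (sigmaZ sigmaP) ev_sdual.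
Qed.

Lemma sigma_img_gsp a : sigma_img sigma (gsp a) = gsp (sdual a).
Proof.
apply/vspaceP => x; rewrite (mem_sigma_img sigmaP); apply/idP/idP => /sigma_gsp.
  by rewrite (sigmaK sigmaP).
by rewrite sdualK.
Qed.

Lemma sdual_root a : root a -> root (sdual a).
Proof.
move=> ra; have [x [y [xa _ x0 _ _]]] := sl2_triple ra.
rewrite rtE; apply/andP; split.
  apply: contraNneq (root_neq0 ra) => e; apply/eqP.
  by rewrite -[a]sdualK e sdual0.
apply/eqP => e; apply: x0; have := sigma_gsp xa.
by rewrite e memv0 => /eqP sx; rewrite -[x](sigmaK sigmaP) sx (sigma0 sigmaP).
Qed.

(** sigma [x, y] = [sigma x, sigma y] is a multiple of the Killing dual of s(a), and s(a) takes the
    value 2 on it. *)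
Lemma sigma_coroot a : root a -> sigma (coroot a) = coroot (sdual a).
Proof.
move=> ra; have rsa := sdual_root ra.
have [x [y [xa ya _ _ et]]] := sl2_triple ra.
have := sigma_br sigmaP x y; rewrite et.
rewrite (br_opposite (sigma_gsp xa)); last by rewrite -sdualN; apply: sigma_gsp.
move: (kappa _ _) => k ek.
have := ev_sdual a (sigmah (coroot_mem a)).
rewrite (sigmaK sigmaP) ev_corootxx // rmorph_nat ek evZr -/(rform _ _) => e2.
rewrite /coroot; congr (_ *: _); apply/eqP; rewrite eq_sym -e2 mulfK //.
by apply/eqP/rform_neq0.
Qed.

Lemma sdual_pairing a b : root a -> root b ->
  ev (sdual b) (coroot (sdual a)) = ev b (coroot a).
Proof.
move=> ra rb; rewrite -(sigma_coroot ra) ev_sdual ?sigmah ?coroot_mem //.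
rewrite (sigmaK sigmaP); have [p [q ->]] := ev_coroot_int ra rb.
by rewrite rmorphB !rmorph_nat.
Qed.

Lemma sdual_refl a b : root a -> root b ->
  sdual (refl a b) = refl (sdual a) (sdual b).
Proof.
move=> ra rb; rewrite /refl sdualD sdualN sdualZ (sdual_pairing ra rb).
suff -> : (ev b (coroot a))^* = ev b (coroot a) by [].
by have [p [q ->]] := ev_coroot_int ra rb; rewrite rmorphB !rmorph_nat.
Qed.

Local Notation roots := (undup rs).

Lemma mem_roots a : (a \in roots) = root a.
Proof. by rewrite mem_undup rsP. Qed.

(** * The exchange argument for a closed set of roots *)

Section Parabolic.
Variable Q : pred (hdual h).
Hypothesis clQ : closed_roots Q.
Hypothesis totQ : forall a, root a -> Q a || Q (- a).

Lemma refl_count_lt a : root a -> Q a -> ~~ Q (- a) ->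
    ~~ Q (sdual a) -> Q (- sdual a) -> Q (refl a (- sdual a)) ->
  (count [pred x : hdual h | Q x && Q (sdual x)] roots <
   count [pred x : hdual h | Q (refl a x) && Q (refl a (sdual x))] roots)%N.
Proof.
move=> ra Qa QNa Qb QNb Qab; set b := sdual a in Qb QNb Qab.
have rb : root b := sdual_root ra.
have ea : sdual b = a by rewrite /b sdualK.
pose Q1 : pred (hdual h) := fun c => Q (sdual c).
pose Q2 : pred (hdual h) := fun c => Q1 (refl b c).
have clQ1 : closed_roots Q1.
  move=> c d rc rd rcd Qc Qd; rewrite /Q1 sdualD.
  have rcd' : root (sdual c + sdual d) by rewrite -sdualD sdual_root.
  exact: (clQ (sdual_root rc) (sdual_root rd) rcd' Qc Qd).
have clQ2 : closed_roots Q2.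
  move=> c d rc rd rcd Qc Qd; rewrite /Q2 reflD.
  have rcd' : root (refl b c + refl b d) by rewrite -reflD refl_root.
  exact: (clQ1 _ _ (refl_root rb rc) (refl_root rb rd) rcd' Qc Qd).
have rr c (x : hdual h) : root c -> x \in roots -> refl c x \in roots.
  by rewrite !mem_roots; apply: refl_root.
have rNb := rootN rb.
have E1 := @rearrangement _ roots (refl b) (undup_uniq _) (fun x : hdual h => @rr b x rb)
  (fun (x : hdual h) _ => reflK rb x) Q Q1.
have E2 := @rearrangement _ roots (refl a) (undup_uniq _) (fun x : hdual h => @rr a x ra)
  (fun (x : hdual h) _ => reflK ra x) Q Q2.
(* Exchange at c = -b, which is in Q, while b is in s(Q) because s(b) = a is in Q. *)
have H1 (x : hdual h) : x \in roots -> (Q x -> Q (refl b x)) /\ (Q1 (refl b x) -> Q1 x) \/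
    (Q (refl b x) -> Q x) /\ (Q1 x -> Q1 (refl b x)).
  rewrite mem_roots -refl_opp => rx; apply: refl_exchange => //.
  by rewrite opprK /Q1 ea.
have H2 (x : hdual h) : x \in roots -> (Q x -> Q (refl a x)) /\ (Q2 (refl a x) -> Q2 x) \/
    (Q (refl a x) -> Q x) /\ (Q2 x -> Q2 (refl a x)).
  rewrite mem_roots => rx; apply: refl_exchange => //.
  by rewrite /Q2 /Q1 sdual_refl ?rootN // ea sdualN.
have {}E1 := E1 H1; have {}E2 := E2 H2.
(* Reindex by r_a and use r_a s = s r_b. *)
have -> : count [pred x : hdual h | Q (refl a x) && Q (refl a (sdual x))] roots =
    count [pred x : hdual h | Q x && Q2 (refl a x)] roots.
  rewrite -(count_involution (undup_uniq _) (fun x : hdual h => @rr a x ra)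
    (fun (x : hdual h) _ => reflK ra x)).
  apply: eq_in_count => x; rewrite mem_roots => rx /=; rewrite reflK //; congr (_ && _).
  by rewrite /Q2 /Q1 (sdual_refl rb (refl_root ra rx)) ea.
rewrite -ltn_double; apply: leq_trans (leq_trans _ E2); last exact: leq_addr.
apply: leq_trans E1; rewrite -[X in (X < _)%N]addn0 ltn_add2l -has_count.
(* The pair {b, -b} makes the first exchange strict: b is not in Q, and -b is not in s(Q) because -a
   is not in Q. *)
apply/hasP; exists (- b); first by rewrite mem_roots.
by rewrite /= reflN reflxx // opprK QNb Qb /Q1 sdualN ea QNa Qa.
Qed.

Lemma exists_refl_count_lt a : root a -> Q a -> ~~ Q (- a) ->
    ~~ Q (sdual a) -> sdual a != - a ->
  exists2 c, root c & (count [pred x : hdual h | Q x && Q (sdual x)] roots <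
   count [pred x : hdual h | Q (refl c x) && Q (refl c (sdual x))] roots)%N.
Proof.
move=> ra Qa QNa Qb bNa; set b := sdual a in Qb bNa.
have rb : root b := sdual_root ra.
have ea : sdual b = a by rewrite /b sdualK.
have QNb : Q (- b) by have := totQ rb; rewrite (negPf Qb).
have ba : b != a by apply: contraNneq Qb => ->.
have sym : ev a (coroot b) = ev b (coroot a).
  by rewrite -(sdual_pairing ra rb) ea.
have [p [q e]] := ev_coroot_int ra rb.
have := symmetric_pairing_ge ra rb ba bNa sym e.
rewrite leq_eqVlt ltnS => /orP[/eqP eq|qp]; last first.
  exists a => //; apply: refl_count_lt => //.
  apply: closed_roots_refl => //; first exact: rootN.
  by rewrite evN e opprB subr_le0 ler_nat.
have {}e : ev b (coroot a) = - 1 by rewrite e eq -natr1 opprD addrA subrr sub0r.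
have rab : root (a + b).
  by have := refl_root ra rb; rewrite /refl e scaleN1r opprK addrC.
have [Qab|Qab] := boolP (Q (- (a + b))).
  exists a => //; apply: refl_count_lt => //.
  by rewrite -/b reflN /refl e scaleN1r opprK addrC.
have {}Qab : Q (a + b) by have := totQ rab; rewrite (negPf Qab) orbF.
(* For the pair (-b, -a) the condition becomes r_b(a) = a + b in Q. *)
exists (- b); first exact: rootN.
apply: refl_count_lt; rewrite ?sdualN ?ea ?opprK //; first exact: rootN.
by rewrite refl_opp /refl sym e scaleN1r opprK.
Qed.

End Parabolic.

(** * Subspaces spanned by root spaces *)

(** The index 0 contributes h, so the results on sums of weight spaces apply directly. *)
Definition hsum (P : pred (hdual h)) : {vspace g} :=
  (\sum_(a <- (0 :: filter P roots)%R) gsp a)%VS.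

Lemma mem_hsum_index (P : pred (hdual h)) a :
  (a \in 0 :: filter P roots) = (a == 0) || P a && root a.
Proof. by rewrite inE mem_filter mem_roots. Qed.

Lemma hsum_uniq (P : pred (hdual h)) : uniq (0 :: filter P roots).
Proof.
rewrite /= filter_uniq ?undup_uniq // andbT mem_filter mem_roots rtE eqxx.
by rewrite andbF.
Qed.

Lemma gsp_hsum (P : pred (hdual h)) a : root a -> P a -> (gsp a <= hsum P)%VS.
Proof. by move=> ra Pa; rewrite gsp_sub_sum // mem_hsum_index ra Pa orbT. Qed.

Lemma cartan_hsum (P : pred (hdual h)) : (h <= hsum P)%VS.
Proof. by rewrite -{1}rootsp0 gsp_sub_sum // mem_head. Qed.

Lemma hsum_stable (P : pred (hdual h)) : stable br h (hsum P).
Proof. exact: (@rootsp_sum_stable _ id). Qed.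

Lemma dim_hsum (P : pred (hdual h)) : \dim (hsum P) = (\dim h + count P roots)%N.
Proof.
rewrite dim_rootsp_sum ?hsum_uniq // big_cons rootsp0 -size_filter; congr addn.
rewrite -sum1_size big_seq [RHS]big_seq; apply: eq_bigr => a.
by rewrite mem_filter mem_roots => /andP[_ /dim_root].
Qed.

Lemma hsum_subv (P : pred (hdual h)) U : (h <= U)%VS ->
  (forall a, root a -> P a -> (gsp a <= U)%VS) -> (hsum P <= U)%VS.
Proof.
move=> hU PU; rewrite /hsum big_seq; elim/big_rec: _ => [|a V aP VU].
  exact: sub0v.
rewrite subv_add VU andbT; move: aP; rewrite mem_hsum_index.
by case/orP => [/eqP ->|/andP[Pa ra]]; rewrite ?rootsp0 ?PU.
Qed.

Lemma mem_hsum_components (P : pred (hdual h)) U v : stable br h U ->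
    (forall a, root a -> ~~ P a -> (gsp a :&: U = 0)%VS) -> v \in U ->
  v \in hsum P.
Proof.
move=> hU PU vU; have [vs ev' Hvs] := weight_decomposition v.
have comp := stable_components hU weights_uniq (fun a _ => Hvs a).
rewrite -ev' in comp; rewrite ev' big_seq rpred_sum // => a aW.
have aU := comp vU a aW.
move: aW; rewrite mem_weights => /orP[/eqP a0|ra].
  by apply: (subvP (cartan_hsum P)); rewrite -rootsp0 -a0.
have [Pa|nPa] := boolP (P a); first by apply: (subvP (gsp_hsum ra Pa)).
have : vs a \in (gsp a :&: U)%VS by rewrite memv_cap Hvs aU.
by rewrite PU // memv0 => /eqP ->; apply: mem0v.
Qed.

Lemma gsp_cap_hsum (P : pred (hdual h)) a : root a -> ~~ P a ->
  (gsp a :&: hsum P = 0)%VS.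
Proof.
move=> ra nPa; apply: rootsp_cap_sum.
by rewrite mem_hsum_index negb_or root_neq0 //= (negPf nPa).
Qed.

Lemma hsum_cap (P P' : pred (hdual h)) :
  (hsum P :&: hsum P')%VS = hsum [pred a : hdual h | P a && P' a].
Proof.
apply/eqP; rewrite eqEsubv; apply/andP; split; last first.
  apply: hsum_subv => [|a ra /andP[Pa Pa']]; first by rewrite subv_cap !cartan_hsum.
  by rewrite subv_cap !gsp_hsum.
apply/subvP => v; apply: mem_hsum_components => [y u yh|a ra].
  by rewrite !memv_cap => /andP[u1 u2]; rewrite !hsum_stable.
rewrite negb_and => /orP[nP|nP]; apply/eqP; rewrite -subv0.
  by rewrite -(gsp_cap_hsum ra nP) capvS ?capvSl.
by rewrite -(gsp_cap_hsum ra nP) capvS ?capvSr.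
Qed.

Lemma sigma_hsum (P : pred (hdual h)) :
  sigma_img sigma (hsum P) = hsum [pred a : hdual h | P (sdual a)].
Proof.
have sub (P1 P2 : pred (hdual h)) : (forall a, root a -> P1 a -> P2 (sdual a)) ->
    (hsum P1 <= sigma_img sigma (hsum P2))%VS.
  move=> P12; apply: hsum_subv => [|a ra Pa]; apply/subvP => x xa.
    by rewrite (mem_sigma_img sigmaP) (subvP (cartan_hsum _)) ?sigmah.
  rewrite (mem_sigma_img sigmaP); apply: (subvP (gsp_hsum (sdual_root ra) _)).
    exact: P12.
  exact: sigma_gsp.
apply/eqP; rewrite eqEsubv sub // andbT; apply/subvP => x.
rewrite (mem_sigma_img sigmaP) => sx; rewrite -[x](sigmaK sigmaP).
rewrite -(mem_sigma_img sigmaP); move: sx; apply: subvP; apply: sub => a ra Pa.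
by rewrite /= sdualK.
Qed.

Lemma gsp_cap0 a U : root a -> ~~ (gsp a <= U)%VS -> (gsp a :&: U = 0)%VS.
Proof.
move=> ra; apply: contraNeq; rewrite -dimv_eq0 -lt0n => d0.
apply/capv_idPl/eqP.
by rewrite eqEdim capvSl dim_root.
Qed.

Lemma hsum_subalgebra q : (h <= q)%VS -> subalgebra br q ->
  q = hsum [pred a : hdual h | (gsp a <= q)%VS].
Proof.
move=> hq sq; apply/eqP; rewrite eqEsubv; apply/andP; split; last first.
  exact: hsum_subv.
apply/subvP => v; apply: mem_hsum_components => [y u yh uq|a ra nPa].
  by apply: sq => //; apply: (subvP hq).
exact: gsp_cap0.
Qed.

(** If the line g^(-a) is not in q, elements of q have no component in it. As g^a pairs only with
    g^(-a), it is orthogonal to q, hence to b, and lies in b^perp <= b <= q. *)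
Lemma parabolic_total q a : (h <= q)%VS -> parabolic br q -> root a ->
  (gsp a <= q)%VS || (gsp (- a)%R <= q)%VS.
Proof.
move=> hq [sq [b [borb bq]]] ra; rewrite orbC -implyNb; apply/implyP => nNa.
apply: (@subv_trans _ _ (perp br b)); last exact: subv_trans (borel_perp lieP borb) bq.
apply/subvP => x xa; apply/(perpP lieP) => u /(subvP bq) uq.
have hstq : stable br h q by move=> y w yh wq; apply: sq => //; apply: (subvP hq).
have [us eu Hus] := weight_decomposition u.
have uNa : us (- a) = 0.
  apply/eqP; rewrite -memv0 -(gsp_cap0 (rootN ra) nNa) memv_cap Hus /=.
  apply: (stable_components hstq weights_uniq (fun c _ => Hus c)).
    by rewrite -eu.
  by rewrite mem_weights rootN // orbT.
rewrite eu; elim: W => [|c s IHs]; first by rewrite big_nil (kappa0l lieP).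
rewrite big_cons (kappaDl lieP) IHs addr0.
have [ac|ac] := eqVneq (c + a) 0; last exact: (kappa_rootsp (Hus c) xa).
have -> : c = - a by apply/eqP; rewrite -addr_eq0 ac.
by rewrite uNa (kappa0l lieP).
Qed.

Lemma subv_big_seq (T : eqType) (i : T) (s : seq T) (P : pred T) (F : T -> {vspace g}) :
  i \in s -> P i -> (F i <= \sum_(j <- s | P j) F j)%VS.
Proof. by move=> si Pi; rewrite (big_rem i si) Pi addvSl. Qed.

(** r_c is its own inverse, so w(Q) is the preimage of Q under r_c. *)
Lemma q_w_hsum q c : root c ->
  q_w br q rs [:: (c, vsproj h (coroot c))] =
  hsum [pred a : hdual h | (gsp (refl c a) <= q)%VS].
Proof.
move=> rc; apply/eqP; rewrite eqEsubv; apply/andP; split.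
  rewrite subv_add cartan_hsum /=.
  rewrite big_seq_cond; elim/big_rec: _ => [|a V /andP[]]; first exact: sub0v.
  rewrite rsP -gspE => ra aq VU; rewrite subv_add VU andbT -gspE.
  rewrite -[root_reflect _ _]/(refl c a) gsp_hsum ?refl_root //=.
  by rewrite reflK.
apply: hsum_subv => [|a ra /= Pa]; first exact: addvSl.
apply: subv_trans (addvSr _ _).
have ars : refl c a \in rs by rewrite rsP refl_root.
have aq : (rootsp br (refl c a) <= q)%VS by rewrite -gspE.
have := @subv_big_seq _ (refl c a) rs (fun b => (rootsp br b <= q)%VS)
  (fun b => rootsp br (refl c b)) ars aq.
rewrite (reflK rc) gspE => H; exact: H.
Qed.

Lemma weyl_word_refl c : root c -> weyl_word br [:: (c, vsproj h (coroot c))].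
Proof.
move=> rc p; rewrite inE => /eqP -> /=; split; first by rewrite /is_root -gspE -rtE.
split; last exact: ev_corootxx.
have [x [y [xc yc _ _ <-]]] := sl2_triple rc.
have xyh : br x y \in h by rewrite -rootsp0 -(subrr c) rootsp_br.
by rewrite vsprojK // -!gspE; apply: mem_brspace.
Qed.

Lemma gsp_inj a b : root a -> gsp a = gsp b -> a = b.
Proof.
move=> ra eab; apply/eqP; apply: contraT => nab.
have ab : a \notin [:: b] by rewrite inE.
have := rootsp_cap_sum ab; rewrite big_seq1 -eab capvv => a0.
by have := dim_root_gt0 ra; rewrite a0 dimv0.
Qed.

Lemma crdim_hsum (P : pred (hdual h)) : crdim sigma (hsum P) =
  (\dim {:g} - (\dim h + count [pred a : hdual h | P a && P (sdual a)] roots))%N.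
Proof. by rewrite /crdim sigma_hsum hsum_cap dim_hsum. Qed.

Lemma minimal_type q a : (h <= q)%VS -> parabolic br q ->
    (forall ws, weyl_word br ws -> (crdim sigma q <= crdim sigma (q_w br q rs ws))%N) ->
    root a -> (gsp a <= q)%VS -> ~~ (gsp (- a)%R <= q)%VS ->
    ~~ (gsp (sdual a) <= q)%VS ->
  sdual a = - a.
Proof.
move=> hq parq minq ra aq naq saq; apply/eqP; apply: contraT => nsa.
have [sq _] := parq.
have [] := @exists_refl_count_lt [pred b : hdual h | (gsp b <= q)%VS] _ _ a => //=.
- by move=> b c rb rc rbc /= bq cq; apply: gsp_add_subv.
- by move=> b rb; apply: parabolic_total.
move=> c rc; rewrite ltnNge => /negP; case.
have := minq _ (weyl_word_refl rc); rewrite q_w_hsum //.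
have -> : crdim sigma q = crdim sigma (hsum [pred b : hdual h | (gsp b <= q)%VS]).
  by rewrite -(hsum_subalgebra hq sq).
(* Subtraction is truncated: reversing the inequality requires that the dimension subtracted for
   [q_w] be at most dim g. *)
rewrite !crdim_hsum leq_sub2lE ?leq_add2l //.
by rewrite -dim_hsum dimvS ?subvf.
Qed.

End RootSpaces.

Theorem theorem5p21 (R : realType) (g : vectType R[i]) (br : g -> g -> g)
  (sigma : g -> g) (q h : {vspace g}) (rs : seq (hdual h)) :
  lie_bracket br -> semisimple br ->
  antilinear_involution br sigma ->
  parabolic br q ->
  (forall x, x \in h -> sigma x \in h) ->
  real_cartan_fixed br sigma h ->
  (forall x, x \in h -> sigma x = x -> x \in q) ->
  (* rs enumerates the root system R(g, h) *)
  (forall a, (a \in rs) = is_root br a) ->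
  (forall ws, weyl_word br ws ->
     (crdim sigma q <= crdim sigma (q_w br q rs ws))%N) ->
  forall a b : hdual h,
    is_root br a -> is_root br b ->
    (rootsp br a <= q)%VS -> ~~ (rootsp br (- a) <= q)%VS ->
    sigma_img sigma (rootsp br a) = rootsp br b ->
    ~~ (rootsp br b <= q)%VS ->
    b = - a.
Proof.
move=> lieP ssP sigmaP parq sigmah cartanh hq rsP minq a b ra rb aq naq sab nbq.
have gspE (c : hdual h) : rootsp br c = rootsp br c := erefl _.
have rtE (c : hdual h) :
  is_root br c = (c != 0) && (rootsp br c != 0%VS) := erefl _.
have subh := complexified_subalgebra lieP sigmaP sigmah cartanh.
have solvh := complexified_solvable lieP sigmaP sigmah cartanh.
have nilh := complexified_nilpotent lieP sigmaP sigmah cartanh.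
have normh := complexified_self_normalizing lieP sigmaP sigmah cartanh.
have hsubq := complexified_subset sigmaP sigmah hq.
(* The root b is identified with [sdual a], since a nonzero root space determines its root. *)
rewrite (sigma_img_gsp lieP gspE sigmaP sigmah) in sab.
have eb := gsp_inj lieP gspE rtE rb (esym sab); rewrite eb in nbq *.
exact: (minimal_type lieP ssP subh solvh nilh normh gspE rtE rsP sigmaP sigmah
  hsubq parq minq ra aq naq nbq).
Qed.
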